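(* Let $m_i=(x_i,y_i)$, $i=1,2,3$, be three generic points of $\mathbb{C}^2$ (identified with the chart $z=1$ of $\mathbb{P}^2(\mathbb{C})$). Let $(a,b,c,A,B,C)\in\mathbb{C}^6$ be a solution of the linear system $$\left\{\begin{array}{l}(x_i^2-y_i)a+(x_iy_i-y_i)b+(x_i-y_i)c=y_i-x_i^2y_i\\ (y_i^2-y_i)A+(x_iy_i-y_i)B+(x_i-y_i)C=y_i-x_iy_i^2\end{array}\right.\qquad i=1,2,3,$$ and put $e=-(1+a+b+c)$, $E=-(1+A+B+C)$. Then the involution associated to the seven points $(1:0:0)$, $(0:1:0)$, $(0:0:1)$, $(1:1:1)$, $m_1$, $m_2$, $m_3$ is given in the affine chart $(x,y)$ by $$(x,y)\mapsto\left(\frac{U_1}{TU_2},\frac{V_1}{TV_2}\right),$$ where $U_1,U_2,V_1,V_2,T\in\mathbb{C}[x,y]$ are the polynomials written out in the context. It is a Geiser involution.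
   Context: ''Generic'' means: for $(m_1,m_2,m_3)$ in some non-empty Zariski open subset of $(\mathbb{C}^2)^3$. Geiser involution associated to seven points: let $p_1,\ldots,p_7$ be seven points of $\mathbb{P}^2(\mathbb{C})$ in general position (no three collinear, no six on a conic). For a generic point $p$, the cubics through $p_1,\ldots,p_7$ and $p$ form a pencil with nine base points: $p_1,\dots,p_7$, $p$ and a ninth one, denoted $\mathcal{I}_G(p)$. The map $p\mapsto\mathcal{I}_G(p)$ is a birational involution of $\mathbb{P}^2(\mathbb{C})$, called the Geiser involution associated to $p_1,\dots,p_7$. It coincides with the involution associated to the unique degree $2$ foliation singular exactly at the seven points (the involution exchanging the two points of tangency of the foliation with a generic line); in the situation of the claim this foliation is defined by the vector field $(x^2y+ax^2+bxy+cx+ey)\frac{\partial}{\partial x}+(xy^2+Ay^2+Bxy+Cx+Ey)\frac{\partial}{\partial y}$. The polynomials are: $$U_2=xy^2+Ay^2+Bxy+Cx+Ey,\qquad V_2=x^2y+ax^2+bxy+cx+ey,$$ $$T=(C-aB+a^2)x^2+(E-c-AB+ab)xy+(bC-cB-AC+ac)x+(bA-A^2-e)y^2+(bE-eB-AE+ae)y,$$ $$\begin{aligned}U_1={}&(B-a)\big(E-A(B-a)\big)x^3y^2+\big(E(aB-a^2+C)+2AC(a-B)\big)x^3y+C(aE-AC)x^3\\&+e(AE-bE-cA+eB)y^3\\&+\big(2(A^2c-eE-bcA-A^2E)-aeA+ce+beB+3bAE-b^2E\big)xy^3\\&+(cE-eC)(E-c)xy+e(eC-cE)y^2\\&+\big(aeB-eC-eB^2+E^2-cE+bBE+2(bAC-acA-A^2C-abE-ABE+cAB)+3aAE\big)x^2y^2\\&+C(cE-eC)x^2\\&+\big(2(cAC-eCB-acE-ACE)+aE^2+cBE+bCE+aeC\big)x^2y\\&+\big(2A(A-b)(a-B)+e(a-B)+(A-b)E\big)x^2y^3\\&+(b-A)\big(e-A(b-A)\big)xy^4\\&+(beC-aeE-c^2A+bE^2-AE^2+3cAE+ceB-eBE-2bcE)xy^2+e(A^2-bA+e)y^4,\end{aligned}$$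 $$\begin{aligned}V_1={}&\big(2a(a-B)(b-A)-ac-AC+bC+cB\big)x^3y^2+(A-b)\big(a(A-b)+c\big)x^2y^3\\&+(a-B)\big(C+a(a-B)\big)x^4y\\&+\big(2(aBE+cC-a^2E+a^2c)-3acB-CE+aAC-bBC+cB^2\big)x^3y\\&+C(cE-eC)x^2+(E-c)(cE-eC)xy\\&+\big(2(aAE-aeB+abc-abE+cAB+a^2e)+b^2C+eC-bcB-c^2-3acA-bAC+cE\big)x^2y^2\\&-C(C-aB+a^2)x^4\\&+(2cBE+aE^2-bCE-3acE-c^2B+bcC+cAC-eCB+ac^2)x^2y\\&+C(aE-bC-ac+cB)x^3+e(ae-cA)y^3\\&+\big(2(ace+beC-aeE+cAE)-c^2A-ceB-eAC-bcE\big)xy^2\\&+\big(cA^2-ce-bcA+2ae(b-A)\big)xy^3+e(eC-cE)y^2.\end{aligned}$$ *)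

(* Defs.v *)
From HB Require Import structures.
From mathcomp Require Import all_boot all_order all_algebra.
From mathcomp Require Import mpoly.

Set Implicit Arguments.
Unset Strict Implicit.
Unset Printing Implicit Defensive.

Import GRing.Theory.
Local Open Scope ring_scope.

Section ZariskiGenericity.
Variable K : fieldType.

Definition mx_eval m n (f : {mpoly K[m * n]}) (M : 'M[K]_(m, n)) : K :=
  f.@[fun k => mxvec M 0 k].

(* The affine space K^(m * n) is taken to be the matrices 'M_(m, n), so that
   'M_(3, 2) is (K^2)^3, a triple of points of the plane being given by the
   three rows. *)
Definition zariski_open m n (U : 'M[K]_(m, n) -> Prop) : Prop :=
  exists S : {mpoly K[m * n]} -> Prop,
    forall M, U M <-> exists2 f, S f & mx_eval f M != 0.

Definition generically m n (Q : 'M[K]_(m, n) -> Prop) : Prop :=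
  exists U : 'M[K]_(m, n) -> Prop,
    [/\ zariski_open U, exists M, U M & forall M, U M -> Q M].

End ZariskiGenericity.

Section ProjectivePlane.
Variable K : fieldType.

(* A point of P^2(K) is given by a nonzero row vector of homogeneous
   coordinates; two such vectors are the same point when they have the same
   row space, i.e. (u == v)%MS. *)
Definition hpoint (x y z : K) : 'rV[K]_3 := \row_(i < 3) [:: x; y; z]`_i.

Definition chart (p : 'rV[K]_2) : 'rV[K]_3 := hpoint (p 0 0) (p 0 1) 1.

Definition feval (n : nat) (F : {mpoly K[n]}) (r : 'rV[K]_n) : K :=
  F.@[fun i => r 0 i].

Definition vanishes_on (s : seq 'rV[K]_3) (F : {mpoly K[3]}) : Prop :=
  forall r, r \in s -> feval F r = 0.

Definition on_curve_of_degree (d : nat) (s : seq 'rV[K]_3) : Prop :=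
  exists2 F : dhomog 3 K d, F != 0 & vanishes_on s F.

(* [subseq t s] selects members of [s] by position: repeated points in [s]
   count with repetition, so general position forces them to be distinct. *)
Definition general_position (s : seq 'rV[K]_3) : Prop :=
  (forall t, subseq t s -> size t = 3%N -> ~ on_curve_of_degree 1 t) /\
  (forall t, subseq t s -> size t = 6%N -> ~ on_curve_of_degree 2 t).

Definition in_points (r : 'rV[K]_3) (s : seq 'rV[K]_3) : bool :=
  has (fun u => (r == u)%MS) s.

Definition distinct_points (s : seq 'rV[K]_3) : bool :=
  pairwise (fun u v => ~~ (u == v)%MS) s.

(* W is the vector space of all cubic forms vanishing on p :: s; it is a pencil
   when dim W = 2. *)
Definition ninth_base_point (s : seq 'rV[K]_3) (p q : 'rV[K]_3) : Prop :=
  exists W : {vspace dhomog 3 K 3},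
    [/\ forall F : dhomog 3 K 3, F \in W <-> vanishes_on (p :: s) F,
        \dim W = 2%N,
        distinct_points (q :: p :: s) &
        forall r : 'rV[K]_3, r != 0 ->
          (forall F : dhomog 3 K 3, F \in W -> feval F r = 0) <->
          in_points r (q :: p :: s)].

(* A foliation of degree 2 of P^2 is given by a homogeneous quadratic vector
   field v on K^3, tangent at r to the line spanned by r and v(r); its singular
   points are those where v(r) is a multiple of r.  When these are finite in
   number, the components of r ^ v(r) have no common factor, so the degree is
   indeed 2. *)
Definition field2 := 'I_3 -> dhomog 3 K 2.

Definition field_at (v : field2) (r : 'rV[K]_3) : 'rV[K]_3 :=
  \row_i feval (v i) r.

Definition singular_exactly_at (v : field2) (s : seq 'rV[K]_3) : Prop :=
  forall r : 'rV[K]_3, r != 0 -> (field_at v r <= r)%MS <-> in_points r s.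

(* A line of P^2 is the row space of a 2 x 3 matrix L of rank 2. *)
Definition tangent_at (v : field2) (L : 'M[K]_(2, 3)) (r : 'rV[K]_3) : bool :=
  (r <= L)%MS && (field_at v r <= L)%MS.

Definition exchanged_tangency_points (v : field2) (p q : 'rV[K]_3) : Prop :=
  exists L : 'M[K]_(2, 3),
    [/\ \rank L = 2%N, distinct_points [:: p; q] &
        forall r : 'rV[K]_3, r != 0 -> tangent_at v L r = in_points r [:: p; q]].

End ProjectivePlane.

Section PlaneRationalMaps.
Variable K : fieldType.

(* (x, y) |-> (num1 / den1, num2 / den2) *)
Record ratmap := RatMap { num1 : {mpoly K[2]}; den1 : {mpoly K[2]};
                          num2 : {mpoly K[2]}; den2 : {mpoly K[2]} }.

Definition defined_at (f : ratmap) (p : 'rV[K]_2) : bool :=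
  (feval (den1 f) p != 0) && (feval (den2 f) p != 0).

Definition apply_map (f : ratmap) (p : 'rV[K]_2) : 'rV[K]_2 :=
  \row_(i < 2) [:: feval (num1 f) p / feval (den1 f) p;
                   feval (num2 f) p / feval (den2 f) p]`_i.

Definition birational_involution (f : ratmap) : Prop :=
  generically (fun p : 'rV[K]_2 =>
    [/\ defined_at f p, defined_at f (apply_map f p) & apply_map f (apply_map f p) = p]).

(* The correspondence I on P^2 is given in the chart z = 1 by f. *)
Definition given_in_chart_by (I : 'rV[K]_3 -> 'rV[K]_3 -> Prop)
    (f : ratmap) : Prop :=
  generically (fun p : 'rV[K]_2 =>
    defined_at f p /\ I (chart p) (chart (apply_map f p))).

(* The involution associated to the points s is that of the degree 2 foliation
   whose singular points are exactly those of s. *)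
Definition is_associated_involution (s : seq 'rV[K]_3) (f : ratmap) : Prop :=
  exists v : field2 K,
    singular_exactly_at v s /\
    given_in_chart_by (exchanged_tangency_points v) f.

Definition is_Geiser_involution (s : seq 'rV[K]_3) (f : ratmap) : Prop :=
  [/\ size s = 7%N, general_position s, birational_involution f &
      given_in_chart_by (ninth_base_point s) f].

End PlaneRationalMaps.

Section ExplicitMap.
Variable K : fieldType.

Definition seven_points (m : 'M[K]_(3, 2)) : seq 'rV[K]_3 :=
  [:: hpoint 1 0 0; hpoint 0 1 0; hpoint 0 0 1; hpoint 1 1 1;
      chart (row 0 m); chart (row 1 m); chart (row 2 m)].

Definition solves_system (m : 'M[K]_(3, 2)) (a b c A B C : K) : Prop :=
  forall i : 'I_3,
    let x := m i 0 in let y := m i 1 in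
    (x ^+ 2 - y) * a + (x * y - y) * b + (x - y) * c = y - x ^+ 2 * y /\
    (y ^+ 2 - y) * A + (x * y - y) * B + (x - y) * C = y - x * y ^+ 2.

Variables a b c e A B C E : K.

Let x : {mpoly K[2]} := 'X_0.
Let y : {mpoly K[2]} := 'X_1.

Definition U2 : {mpoly K[2]} :=
  x * y ^+ 2
  + A *: (y ^+ 2)
  + B *: (x * y)
  + C *: x
  + E *: y.

Definition V2 : {mpoly K[2]} :=
  x ^+ 2 * y
  + a *: (x ^+ 2)
  + b *: (x * y)
  + c *: x
  + e *: y.

Definition T : {mpoly K[2]} :=
  (C - a * B + a ^+ 2) *: (x ^+ 2)
  + (E - c - A * B + a * b) *: (x * y)
  + (b * C - c * B - A * C + a * c) *: x
  + (b * A - A ^+ 2 - e) *: (y ^+ 2)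
  + (b * E - e * B - A * E + a * e) *: y.

Definition U1 : {mpoly K[2]} :=
  ((B - a) * (E - A * (B - a))) *: (x ^+ 3 * y ^+ 2)
  + (E * (a * B - a ^+ 2 + C) + 2 * A * C * (a - B)) *: (x ^+ 3 * y)
  + (C * (a * E - A * C)) *: (x ^+ 3)
  + (e * (A * E - b * E - c * A + e * B)) *: (y ^+ 3)
  + (2 * (A ^+ 2 * c - e * E - b * c * A - A ^+ 2 * E) - a * e * A + c * e +
      b * e * B + 3 * b * A * E - b ^+ 2 * E) *: (x * y ^+ 3)
  + ((c * E - e * C) * (E - c)) *: (x * y)
  + (e * (e * C - c * E)) *: (y ^+ 2)
  + (a * e * B - e * C - e * B ^+ 2 + E ^+ 2 - c * E + b * B * E +
      2 * (b * A * C - a * c * A - A ^+ 2 * C - a * b * E - A * B * E +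
      c * A * B) + 3 * a * A * E) *: (x ^+ 2 * y ^+ 2)
  + (C * (c * E - e * C)) *: (x ^+ 2)
  + (2 * (c * A * C - e * C * B - a * c * E - A * C * E) + a * E ^+ 2 +
      c * B * E + b * C * E + a * e * C) *: (x ^+ 2 * y)
  + (2 * A * (A - b) * (a - B) + e * (a - B) + (A -
      b) * E) *: (x ^+ 2 * y ^+ 3)
  + ((b - A) * (e - A * (b - A))) *: (x * y ^+ 4)
  + (b * e * C - a * e * E - c ^+ 2 * A + b * E ^+ 2 - A * E ^+ 2 +
      3 * c * A * E + c * e * B - e * B * E - 2 * b * c * E) *: (x * y ^+ 2)
  + (e * (A ^+ 2 - b * A + e)) *: (y ^+ 4).

Definition V1 : {mpoly K[2]} :=
  (2 * a * (a - B) * (b - A) - a * c - A * C + b * C +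
      c * B) *: (x ^+ 3 * y ^+ 2)
  + ((A - b) * (a * (A - b) + c)) *: (x ^+ 2 * y ^+ 3)
  + ((a - B) * (C + a * (a - B))) *: (x ^+ 4 * y)
  + (2 * (a * B * E + c * C - a ^+ 2 * E + a ^+ 2 * c) - 3 * a * c * B - C * E
      + a * A * C - b * B * C + c * B ^+ 2) *: (x ^+ 3 * y)
  + (C * (c * E - e * C)) *: (x ^+ 2)
  + ((E - c) * (c * E - e * C)) *: (x * y)
  + (2 * (a * A * E - a * e * B + a * b * c - a * b * E + c * A * B +
      a ^+ 2 * e) + b ^+ 2 * C + e * C - b * c * B - c ^+ 2 - 3 * a * c * A -
      b * A * C + c * E) *: (x ^+ 2 * y ^+ 2)
  + (- C * (C - a * B + a ^+ 2)) *: (x ^+ 4)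
  + (2 * c * B * E + a * E ^+ 2 - b * C * E - 3 * a * c * E - c ^+ 2 * B +
      b * c * C + c * A * C - e * C * B + a * c ^+ 2) *: (x ^+ 2 * y)
  + (C * (a * E - b * C - a * c + c * B)) *: (x ^+ 3)
  + (e * (a * e - c * A)) *: (y ^+ 3)
  + (2 * (a * c * e + b * e * C - a * e * E + c * A * E) - c ^+ 2 * A -
      c * e * B - e * A * C - b * c * E) *: (x * y ^+ 2)
  + (c * A ^+ 2 - c * e - b * c * A + 2 * a * e * (b - A)) *: (x * y ^+ 3)
  + (e * (e * C - c * E)) *: (y ^+ 2).

Definition explicit_map : ratmap K := RatMap U1 (T * U2) V1 (T * V2).

End ExplicitMap.

(* Main.v *)
Require Import Defs.
From mathcomp Require Import all_boot all_order all_algebra.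
From mathcomp Require Import reals complex.
From mathcomp Require Import mpoly ring.

Set Implicit Arguments.
Unset Strict Implicit.
Unset Printing Implicit Defensive.

Import GRing.Theory Num.Theory.
Local Open Scope ring_scope.

(** Let v be the homogeneous quadratic vector field with components
    a x^2 + b x y + c x z + e y z, A y^2 + B x y + C x z + E y z and - x y.  In
    the chart z = 1 it is, up to a multiple of the radial field, the affine field
    V2 d/dx + U2 d/dy; the linear systems and the definitions of e and E say that
    it is singular at m1, m2, m3 and (1, 1), and it is always singular at the
    three coordinate points.

    The explicit map exchanges tangency points.  Let p = (x : y : 1), and let L
    be the tangent line to the foliation at p, spanned by p and
    d = (V2 : U2 : 0), with equation l = p x d.  The points of L where v is
    tangent to L are the zeros of the binary quadratic form
    l (v (s p + t d)), which is t (shift s - T U2 V2 t) ([tangency_form]); so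
    besides p there is exactly one other tangency point, p + shift / (T U2 V2) d.
    The polynomials of the statement satisfy U1 = x T U2 + shift and
    V1 = y T V2 + shift, hence this point is the image of p ([tangent_leafP], [feval_U1], [feval_V1]).  The image
    q lies on the same line L, which is also the tangent line at q, so the map is
    an involution ([conj_pointK]).

    It is the Geiser involution.  For a vector al the cubic det (al, r, v r)
    vanishes at the singular points of v, and for generic points there is no other
    cubic through them ([cubics_through_seven]).  Such a cubic passes through p
    exactly when al is a combination of p and d, which gives a pencil; r is a base
    point of it when r x v r is orthogonal to p and d, that is, either r is
    singular or r and v r both lie on L ([net_leaf]).  So the base points are the seven singular points
    and the two tangency points ([ninth_conj]).

    That v has no further singular point comes from eliminating y between U2 and
    V2: the abscissae other than 0 are roots of a quartic, of which four roots
    are known ([affine_singular]).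

    All this holds under finitely many conditions f <> 0, where f is built
    from the coordinates of the points by ring operations and divisions.  Such an
    f is a quotient of polynomials near any place where the divisors do not
    vanish ([regular]), so it is enough to exhibit one triple of points, and one
    p, at which no f vanishes; rational ones exist ([near_solution],
    [near_line_generic]), and there the conditions are decided by computing in
    the rational numbers. *)

(** * Zariski neighbourhoods *)

Section Neighbourhoods.
Variables (K : fieldType) (m n : nat) (M0 : 'M[K]_(m, n)).
Implicit Types (Q : 'M[K]_(m, n) -> Prop) (phi psi : 'M[K]_(m, n) -> K).

Lemma mx_evalM (g h : {mpoly K[m * n]}) M :
  mx_eval (g * h) M = mx_eval g M * mx_eval h M.
Proof. exact: mevalM. Qed.

Lemma mx_evalD (g h : {mpoly K[m * n]}) M :
  mx_eval (g + h) M = mx_eval g M + mx_eval h M.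
Proof. exact: mevalD. Qed.

(** A basic Zariski neighbourhood of [M0].  Unlike genericity, nearness to one
    fixed matrix is visibly stable under conjunction. *)
Definition near Q : Prop :=
  exists2 g, mx_eval g M0 != 0 & forall M, mx_eval g M != 0 -> Q M.

Lemma near_generically Q : near Q -> generically Q.
Proof.
case=> g g0 gQ; exists (fun M => mx_eval g M != 0); split=> //; last by exists M0.
exists (fun f => f = g) => M; split=> [gM | [f -> //]].
by exists g.
Qed.

Lemma near_mono Q1 Q2 : (forall M, Q1 M -> Q2 M) -> near Q1 -> near Q2.
Proof. by move=> Q12 [g g0 gQ]; exists g => // M /gQ/Q12. Qed.

Lemma near_and Q1 Q2 : near Q1 -> near Q2 -> near (fun M => Q1 M /\ Q2 M).
Proof.
case=> g g0 gQ [h h0 hQ]; exists (g * h).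
  by rewrite mx_evalM mulf_neq0.
by move=> M; rewrite mx_evalM mulf_eq0 negb_or => /andP[/gQ ? /hQ].
Qed.

Lemma near_all (I : eqType) (s : seq I) (Q : I -> 'M[K]_(m, n) -> Prop) :
  (forall i, i \in s -> near (Q i)) ->
  near (fun M => forall i, i \in s -> Q i M).
Proof.
elim: s => [|i s IHs] nearQ.
  by exists 1 => //; rewrite /mx_eval meval1 oner_eq0.
have nearQs: near (fun M => forall j, j \in s -> Q j M).
  by apply: IHs => j sj; apply: nearQ; rewrite inE sj orbT.
have nearQi: near (Q i) by apply: nearQ; rewrite mem_head.
apply: near_mono (near_and nearQi nearQs) => M [Qi Qs] j.
by rewrite inE => /predU1P[-> | /Qs].
Qed.

(** Membership of the germ of [phi] in the local ring of affine space at [M0]. *)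
Definition regular phi : Prop :=
  exists g h, mx_eval h M0 != 0 /\
    forall M, mx_eval h M != 0 -> phi M = mx_eval g M / mx_eval h M.

Lemma regular_neq0 phi : regular phi -> phi M0 != 0 -> near (fun M => phi M != 0).
Proof.
case=> g [h [h0 phiE]]; rewrite phiE // => gh0; exists (g * h).
  rewrite mx_evalM mulf_neq0 //.
  by apply: contraNneq gh0 => ->; rewrite mul0r.
move=> M; rewrite mx_evalM mulf_eq0 negb_or => /andP[gM hM].
by rewrite phiE // mulf_neq0 ?invr_eq0.
Qed.

Lemma regular_cst k : regular (fun=> k).
Proof.
exists k%:MP, 1; rewrite /mx_eval meval1 oner_eq0; split=> // M _.
by rewrite meval1 mevalC divr1.
Qed.

Lemma regular_entry i j : regular (fun M => M i j).
Proof.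
exists 'X_(mxvec_index i j), 1; rewrite /mx_eval meval1 oner_eq0; split=> // M _.
by rewrite meval1 mevalXU mxvecE divr1.
Qed.

Lemma regularD phi psi :
  regular phi -> regular psi -> regular (fun M => phi M + psi M).
Proof.
case=> g1 [h1 [h1M0 E1]] [g2 [h2 [h2M0 E2]]].
exists (g1 * h2 + g2 * h1), (h1 * h2).
rewrite mx_evalM mulf_neq0 //; split=> // M.
rewrite mx_evalM mulf_eq0 negb_or => /andP[h1M h2M].
by rewrite E1 // E2 // addf_div // mx_evalD !mx_evalM.
Qed.

Lemma regularM phi psi :
  regular phi -> regular psi -> regular (fun M => phi M * psi M).
Proof.
case=> g1 [h1 [h1M0 E1]] [g2 [h2 [h2M0 E2]]].
exists (g1 * g2), (h1 * h2).
rewrite mx_evalM mulf_neq0 //; split=> // M.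
rewrite mx_evalM mulf_eq0 negb_or => /andP[h1M h2M].
by rewrite E1 // E2 // !mx_evalM mulf_div.
Qed.

Lemma regularN phi : regular phi -> regular (fun M => - phi M).
Proof.
case=> g [h [hM0 E]]; exists (- g), h; split=> // M hM.
by rewrite E // /mx_eval mevalN mulNr.
Qed.

Lemma regularX phi k : regular phi -> regular (fun M => phi M ^+ k).
Proof.
move=> rphi; elim: k => [|k IHk]; first exact: regular_cst.
suff: regular (fun M => phi M * phi M ^+ k) by case: k {IHk}.
exact: regularM.
Qed.

(** A germ that does not vanish at [M0] is a unit of the local ring. *)
Lemma regularV phi : regular phi -> phi M0 != 0 -> regular (fun M => (phi M)^-1).
Proof.
case=> g [h [hM0 E]]; rewrite E // => ghM0; exists (h * h), (g * h).
have gM0: mx_eval g M0 != 0 by apply: contraNneq ghM0 => ->; rewrite mul0r.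
rewrite mx_evalM mulf_neq0 //; split=> // M.
rewrite mx_evalM mulf_eq0 negb_or => /andP[gM hM].
by rewrite E // invf_div !mx_evalM -mulf_div divff ?mulr1.
Qed.

End Neighbourhoods.

(** * Ternary forms by their coefficients, and points of the plane *)

Section TernaryForms.
Variable K : fieldType.

Definition mon i j k : 'X_{1..3} := [multinom [tuple i; j; k]].

Lemma mdeg_mon i j k : mdeg (mon i j k) = (i + j + k)%N.
Proof. by rewrite mdegE !big_ord_recr big_ord0 /= !multinomE /= !(tnth_nth 0) /= add0n. Qed.

Lemma monE (u : 'X_{1..3}) : u = mon (u ord0) (u (inord 1)) (u (inord 2)).
Proof.
apply/mnmP=> i; rewrite multinomE (tnth_nth 0).
by case: i => [[|[|[|i]]] ilt] //=; congr (u _); apply/val_inj; rewrite //= inordK.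
Qed.

Lemma mon_inj i j k i' j' k' :
  (mon i j k == mon i' j' k') = [&& i == i', j == j' & k == k'].
Proof.
apply/eqP/and3P=> [E | [/eqP-> /eqP-> /eqP->] //].
have M l := congr1 (fun u : 'X_{1..3} => u (inord l)) E.
by split; apply/eqP; [move: (M 0) | move: (M 1) | move: (M 2)];
   rewrite !multinomE !(tnth_nth 0) !inordK.
Qed.

(** The exponent of the third variable is determined by the degree, so a form is
    known from its coefficients indexed by the first two exponents. *)
Lemma homog_eq d (F G : {mpoly K[3]}) : F \is d.-homog -> G \is d.-homog ->
  (forall i j, (i + j <= d)%N ->
     F@_(mon i j (d - i - j)) = G@_(mon i j (d - i - j))) -> F = G.
Proof.
move=> homF homG FG; apply/mpolyP=> u; have [du | ndu] := eqVneq (mdeg u) d; last first.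
  by rewrite (dhomog_nemf_coeff homF) // (dhomog_nemf_coeff homG).
have duE: (u ord0 + u (inord 1) + u (inord 2))%N = d by rewrite -mdeg_mon -monE.
rewrite [u]monE.
have ->: u (inord 2) = (d - u ord0 - u (inord 1))%N.
  by rewrite -duE -addnA addKn addKn.
by apply: FG; rewrite -duE leq_addr.
Qed.

Definition form_poly d (c : nat -> nat -> K) : {mpoly K[3]} :=
  \sum_(i < d.+1) \sum_(j < (d - i).+1) c i j *: 'X_[mon i j (d - i - j)].

Lemma form_homog d c : form_poly d c \is d.-homog.
Proof.
apply: rpred_sum => i _; apply: rpred_sum => j _; apply/rpredZ.
rewrite dhomogX -[X in X == _]/(mdeg _) mdeg_mon -subnDA subnKC //.
by rewrite -leq_subRL -ltnS ltn_ord.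
Qed.

(** The form of degree [d] in which [c i j] multiplies x^i y^j z^(d-i-j). *)
Definition tform d c : dhomog 3 K d := DHomog (form_homog d c).

Lemma coef_tform d c i j : (i + j <= d)%N -> (tform d c)@_(mon i j (d - i - j)) = c i j.
Proof.
move=> ijd; rewrite /= raddf_sum /=.
have ilt: (i < d.+1)%N by rewrite ltnS (leq_trans _ ijd) ?leq_addr.
have jlt: (j < (d - i).+1)%N by rewrite ltnS leq_subRL.
rewrite (bigD1 (Ordinal ilt)) //= raddf_sum (bigD1 (Ordinal jlt)) //=.
rewrite mcoeffZ mcoeffX eqxx mulr1 !big1 ?addr0 // => [k | k].
  move=> ki; rewrite raddf_sum big1 // => l _.
  by rewrite /= mcoeffZ mcoeffX mon_inj -val_eqE in ki *; rewrite (negPf ki) mulr0.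
by move=> kj; rewrite /= mcoeffZ mcoeffX mon_inj -val_eqE in kj *; rewrite (negPf kj) andbF mulr0.
Qed.

Lemma tform_inj d c c' : tform d c = tform d c' ->
  forall i j, (i + j <= d)%N -> c i j = c' i j.
Proof. by move=> E i j ijd; rewrite -(coef_tform c ijd) E coef_tform. Qed.

Lemma eq_tform d c c' :
  (forall i j, (i + j <= d)%N -> c i j = c' i j) -> tform d c = tform d c'.
Proof.
move=> cc'; apply/val_inj/(@homog_eq d) => [||i j ijd]; try exact: form_homog.
by rewrite !(coef_tform _ ijd) cc'.
Qed.

Lemma tformP d (F : dhomog 3 K d) : exists c, F = tform d c.
Proof.
exists (fun i j => F@_(mon i j (d - i - j))).
apply/val_inj/(@homog_eq d) => [||i j ijd];
  [exact: dhomog_is_dhomog | exact: form_homog |].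
by rewrite coef_tform.
Qed.

Lemma tform_lin d k c c' :
  k *: tform d c + tform d c' = tform d (fun i j => k * c i j + c' i j).
Proof.
apply/val_inj/(@homog_eq d) => [||i j ijd].
  exact: rpredD (rpredZ _ (form_homog _ _)) (form_homog _ _).
  exact: form_homog.
by rewrite mcoeffD mcoeffZ !(coef_tform _ ijd).
Qed.

Lemma feval_tform d c (r : 'rV[K]_3) : feval (tform d c) r =
  \sum_(i < d.+1) \sum_(j < (d - i).+1)
     c i j * (r 0 0 ^+ i * r 0 1 ^+ j * r 0 (inord 2) ^+ (d - i - j)).
Proof.
rewrite /feval /= raddf_sum; apply: eq_bigr => i _; rewrite raddf_sum.
apply: eq_bigr => j _; rewrite /= mevalZ mevalX !big_ord_recl big_ord0 mulr1.
rewrite mulrA !multinomE !(tnth_nth 0) /=.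
by congr (_ * (_ * _ ^+ _ * _ ^+ _)); congr (r _ _); apply/val_inj; rewrite //= inordK.
Qed.

Lemma hpoint_eta (r : 'rV[K]_3) : r = hpoint (r 0 0) (r 0 1) (r 0 (inord 2)).
Proof.
apply/rowP=> i; rewrite !mxE.
by case: i => [[|[|[|i]]] ilt] //=; congr (r _ _); apply/val_inj; rewrite //= inordK.
Qed.

Lemma hpoint0 x y z : hpoint x y z 0 0 = x :> K. Proof. by rewrite mxE. Qed.
Lemma hpoint1 x y z : hpoint x y z 0 1 = y :> K. Proof. by rewrite mxE. Qed.
Lemma hpoint2 x y z : hpoint x y z 0 (inord 2) = z :> K.
Proof. by rewrite mxE inordK. Qed.
Definition hpointE := (hpoint0, hpoint1, hpoint2).

Lemma hpoint_inj x y z x' y' z' : hpoint x y z = hpoint x' y' z' :> 'rV[K]_3 ->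
  [/\ x = x', y = y' & z = z'].
Proof.
move=> E; split.
- by rewrite -(hpoint0 x y z) E hpoint0.
- by rewrite -(hpoint1 x y z) E hpoint1.
- by rewrite -(hpoint2 x y z) E hpoint2.
Qed.

Lemma hpoint_lin k x y z x' y' z' :
  k *: hpoint x y z + hpoint x' y' z' =
  hpoint (k * x + x') (k * y + y') (k * z + z') :> 'rV[K]_3.
Proof. by apply/rowP=> i; rewrite !mxE; case: i => [[|[|[|i]]] ilt]. Qed.

Lemma hpointZ k x y z :
  k *: hpoint x y z = hpoint (k * x) (k * y) (k * z) :> 'rV[K]_3.
Proof. by apply/rowP=> i; rewrite !mxE; case: i => [[|[|[|i]]] ilt]. Qed.

Lemma hpoint_eq0 x y z : (hpoint x y z == 0 :> 'rV[K]_3) = [&& x == 0, y == 0 & z == 0].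
Proof.
have e0: 0 = hpoint 0 0 0 :> 'rV[K]_3.
  by apply/rowP=> i; rewrite !mxE; case: i => [[|[|[|i]]] ilt].
apply/eqP/and3P => [|[/eqP-> /eqP-> /eqP-> //]]; rewrite e0.
by case/hpoint_inj=> -> -> ->; rewrite eqxx.
Qed.

Lemma same_pointP (u w : 'rV[K]_3) : w != 0 ->
  reflect (exists2 k, k != 0 & u = k *: w) (u == w)%MS.
Proof.
move=> w0; apply: (iffP idP) => [/andP[/sub_rVP[k ->] wu] | [k k0 ->]].
  exists k => //; apply: contraNneq w0 => k0.
  by case/sub_rVP: wu => l ->; rewrite k0 scale0r scaler0.
by apply/eqmxP/eqmx_scale.
Qed.

End TernaryForms.

Section SmallForms.
Variable K : fieldType.
Implicit Types (c : nat -> nat -> K) (X Y Z : K).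

Lemma feval_form1 c X Y Z : feval (tform 1%N c) (hpoint X Y Z) =
  c 0%N 0%N * Z + c 0%N 1%N * Y + c 1%N 0%N * X.
Proof.
rewrite feval_tform !hpointE !(big_ord_recl, big_ord0) /= /bump /= ?subn0 ?subSS ?sub0n.
ring.
Qed.

Lemma feval_form2 c X Y Z : feval (tform 2%N c) (hpoint X Y Z) =
  c 0%N 0%N * Z ^+ 2 + c 0%N 1%N * (Y * Z) + c 0%N 2%N * Y ^+ 2
  + c 1%N 0%N * (X * Z) + c 1%N 1%N * (X * Y) + c 2%N 0%N * X ^+ 2.
Proof.
rewrite feval_tform !hpointE !(big_ord_recl, big_ord0) /= /bump /= ?subn0 ?subSS ?sub0n.
ring.
Qed.

Lemma feval_form3 c X Y Z : feval (tform 3%N c) (hpoint X Y Z) =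
  c 0%N 0%N * Z ^+ 3 + c 0%N 1%N * (Y * Z ^+ 2) + c 0%N 2%N * (Y ^+ 2 * Z) + c 0%N 3%N * Y ^+ 3
  + c 1%N 0%N * (X * Z ^+ 2) + c 1%N 1%N * (X * Y * Z) + c 1%N 2%N * (X * Y ^+ 2)
  + c 2%N 0%N * (X ^+ 2 * Z) + c 2%N 1%N * (X ^+ 2 * Y) + c 3%N 0%N * X ^+ 3.
Proof.
rewrite feval_tform !hpointE !(big_ord_recl, big_ord0) /= /bump /= ?subn0 ?subSS ?sub0n.
ring.
Qed.

End SmallForms.

Section Evaluation.
Variables (K : fieldType) (n : nat) (p : 'rV[K]_n).
Implicit Types (F G : {mpoly K[n]}) (k l : K).

(** Stated for an undetermined value, so that the value of a large polynomial is
    assembled along its structure. *)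
Lemma evalD F G k l : feval F p = k -> feval G p = l -> feval (F + G) p = k + l.
Proof. by move=> <- <-; apply: mevalD. Qed.

Lemma evalZ F k l : feval F p = l -> feval (k *: F) p = k * l.
Proof. by move=> <-; apply: mevalZ. Qed.

Lemma evalM F G k l : feval F p = k -> feval G p = l -> feval (F * G) p = k * l.
Proof. by move=> <- <-; apply: mevalM. Qed.

Lemma evalXn F k i : feval F p = k -> feval (F ^+ i) p = k ^+ i.
Proof. by move=> <-; apply: rmorphXn. Qed.

Lemma evalX i : feval 'X_i p = p 0 i.
Proof. exact: mevalXU. Qed.

End Evaluation.

Ltac eval_poly :=
  repeat first [apply: evalX | apply: evalXn | apply: evalD | apply: evalZ | apply: evalM].

Section Points.
Variable K : fieldType.
Implicit Types (X Y Z x y : K) (u w : 'rV[K]_3).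

(** Proportionality as the vanishing of the cross product. *)
Lemma sub_pointP X Y Z X' Y' Z' : hpoint X Y Z != 0 ->
  reflect [/\ Y * Z' = Z * Y', Z * X' = X * Z' & X * Y' = Y * X']
          (hpoint X' Y' Z' <= hpoint X Y Z)%MS.
Proof.
rewrite hpoint_eq0 !negb_and => nz; apply: (iffP idP) => [/sub_rVP[k] | [E1 E2 E3]].
  by rewrite hpointZ => /hpoint_inj[-> -> ->]; split; ring.
have K3 k l l' : k != 0 -> k * l' = l * k -> l' = l :> K.
  by move=> k0; rewrite mulrC => /(mulIf k0).
apply/sub_rVP; case/or3P: nz => nz; [exists (X' / X) | exists (Y' / Y) | exists (Z' / Z)];
  rewrite hpointZ; congr (hpoint _ _ _); apply: (K3 _ _ _ nz);
  by rewrite mulrAC divfK // [RHS]mulrC.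
Qed.

Definition apoint (q : K * K) := hpoint q.1 q.2 1.

Lemma apoint_neq0 q : apoint q != 0.
Proof. by rewrite hpoint_eq0 oner_eq0 !andbF. Qed.

Lemma same_apoint q q' : (apoint q == apoint q')%MS = (q == q').
Proof.
case: q q' => x y [x' y']; apply/same_pointP/eqP => [|[k _]|<-].
- exact: apoint_neq0.
- by rewrite hpointZ mulr1 => /hpoint_inj[/= -> -> <-]; rewrite !mul1r.
- by exists 1; rewrite ?oner_eq0 ?scale1r.
Qed.

Lemma apointZ X Y Z : Z != 0 -> hpoint X Y Z = Z *: apoint (X / Z, Y / Z).
Proof. by move=> Z0; rewrite hpointZ /= mulr1 !(mulrC Z) !divfK. Qed.

Lemma in_pointsP u (s : seq 'rV[K]_3) : 0 \notin s ->
  reflect (exists w k, [/\ w \in s, k != 0 & u = k *: w]) (in_points u s).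
Proof.
move=> s0; have nz w: w \in s -> w != 0 by apply: contraTneq => ->.
apply: (iffP hasP) => [[w sw /(same_pointP _ (nz w sw))[k k0 ->]] | [w [k [sw k0 ->]]]].
  by exists w, k.
by exists w => //; apply/(same_pointP _ (nz w sw)); exists k.
Qed.

(** The three coordinate points come first; only four points [s] of the chart
    z = 1 are free. *)
Definition seven (s : seq (K * K)) : seq 'rV[K]_3 :=
  [:: hpoint 1 0 0, hpoint 0 1 0 & map apoint ((0, 0) :: s)].

Lemma seven_neq0 s : 0 \notin seven s.
Proof.
apply/negP; rewrite 2!in_cons => /or3P[/eqP/esym | /eqP/esym | /mapP[q _] /esym] /eqP;
  by rewrite hpoint_eq0 oner_eq0 ?andbF.
Qed.

End Points.

(** * The foliation, its singular points and its tangencies with a line *)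

Section Foliation.
Variable K : fieldType.
Variables a b c e A B C E : K.
Implicit Types (x y s t k X Y Z : K).

Definition U_at x y := x * y ^+ 2 + A * y ^+ 2 + B * (x * y) + C * x + E * y.
Definition V_at x y := x ^+ 2 * y + a * x ^+ 2 + b * (x * y) + c * x + e * y.
(** A conic because the terms of degree three and more cancel; the polynomial [T]
    of the statement is its expansion ([feval_T]). *)
Definition T_at x y := (a - B - y) * V_at x y + (b - A + x) * U_at x y.

(** With z = 1, the first two components are V2 - x (x y) and U2 - y (x y): the
    radial field times x y has been subtracted. *)
Definition field_x X Y Z := a * X ^+ 2 + b * (X * Y) + c * (X * Z) + e * (Y * Z).
Definition field_y X Y Z := A * Y ^+ 2 + B * (X * Y) + C * (X * Z) + E * (Y * Z).
Definition field_z X Y : K := - (X * Y).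

(** The equation of the tangent line at (x : y : 1), namely the cross product of
    this point with the direction (V2 : U2 : 0). *)
Definition line_form x y X Y Z :=
  - U_at x y * X + V_at x y * Y + (x * U_at x y - y * V_at x y) * Z.

(** The line form applied to twice the polar form of the quadratic vector field at
    the point (x : y : 1) and the direction (V2 : U2 : 0). *)
Definition shift x y :=
  let u := U_at x y in let v := V_at x y in
  line_form x y (2 * a * x * v + b * (x * u + y * v) + c * v + e * u)
                (2 * A * y * u + B * (x * u + y * v) + C * v + E * u)
                (- (x * u + y * v)).

(** The form in (s, t) that vanishes where the foliation is tangent to the line.
    The coefficient of s^2 is zero because the line was chosen tangent at
    (x : y : 1); the one of t^2 factors because the third coordinate of the
    direction (V2 : U2 : 0) vanishes. *)
Lemma tangency_form x y s t :
  let X := s * x + t * V_at x y in let Y := s * y + t * U_at x y in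
  line_form x y (field_x X Y s) (field_y X Y s) (field_z X Y)
  = t * (shift x y * s - T_at x y * U_at x y * V_at x y * t).
Proof.
have Ex: a * x ^+ 2 + b * (x * y) + c * x + e * y = V_at x y - x ^+ 2 * y.
  by rewrite /V_at; ring.
have Ey: A * y ^+ 2 + B * (x * y) + C * x + E * y = U_at x y - x * y ^+ 2.
  by rewrite /U_at; ring.
rewrite /shift /line_form /field_x /field_y /field_z /T_at /=.
move: (U_at x y) (V_at x y) Ex Ey => u v Ex Ey.
apply/eqP; rewrite -subr_eq0; apply/eqP.
(* The values of U2 and V2 stay opaque except in the coefficient of s^2. *)
transitivity (s ^+ 2 * (- u * (a * x ^+ 2 + b * (x * y) + c * x + e * y
  - (v - x ^+ 2 * y)) + v * (A * y ^+ 2 + B * (x * y) + C * x + E * y - (u - x * y ^+ 2)))).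
  ring.
by rewrite Ex Ey; ring.
Qed.

Lemma feval_U2 p : feval (U2 A B C E) p = U_at (p 0 0) (p 0 1).
Proof. by rewrite /U2; etransitivity; [eval_poly | rewrite /U_at; ring]. Qed.

Lemma feval_V2 p : feval (V2 a b c e) p = V_at (p 0 0) (p 0 1).
Proof. by rewrite /V2; etransitivity; [eval_poly | rewrite /V_at; ring]. Qed.

Lemma feval_T p : feval (T a b c e A B C E) p = T_at (p 0 0) (p 0 1).
Proof. by rewrite /T; etransitivity; [eval_poly | rewrite /T_at /U_at /V_at; ring]. Qed.

(** The same displacement appears in both numerators: the map moves the point by
    [shift] / (T U2 V2) times (V2, U2). *)
Lemma feval_U1 p : feval (U1 a b c e A B C E) p =
  p 0 0 * T_at (p 0 0) (p 0 1) * U_at (p 0 0) (p 0 1) + shift (p 0 0) (p 0 1).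
Proof.
by rewrite /U1; etransitivity;
  [eval_poly | rewrite /shift /line_form /T_at /U_at /V_at; ring].
Qed.

Lemma feval_V1 p : feval (V1 a b c e A B C E) p =
  p 0 1 * T_at (p 0 0) (p 0 1) * V_at (p 0 0) (p 0 1) + shift (p 0 0) (p 0 1).
Proof.
by rewrite /V1; etransitivity;
  [eval_poly | rewrite /shift /line_form /T_at /U_at /V_at; ring].
Qed.

Definition field_coefs : seq (seq (seq K)) :=
  [:: [:: [:: 0; e; 0]; [:: c; b]; [:: a]];
      [:: [:: 0; E; A]; [:: C; B]; [:: 0]];
      [:: [:: 0; 0; 0]; [:: 0; -1]; [:: 0]]].

Definition foliation : field2 K :=
  fun l => tform 2 (fun i j => (nth [::] (nth [::] field_coefs l) i)`_j).

Lemma field_atE X Y Z :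
  field_at foliation (hpoint X Y Z) = hpoint (field_x X Y Z) (field_y X Y Z) (field_z X Y).
Proof.
apply/rowP=> i; rewrite !mxE feval_form2.
by case: i => [[|[|[|i]]] ilt] //=; rewrite /field_x /field_y /field_z; ring.
Qed.

Definition cross_x X Y Z := Y * field_z X Y - Z * field_y X Y Z.
Definition cross_y X Y Z := Z * field_x X Y Z - X * field_z X Y.
Definition cross_z X Y Z := X * field_y X Y Z - Y * field_x X Y Z.

Lemma cross_affine x y k :
  [/\ cross_x (k * x) (k * y) k = - k ^+ 3 * U_at x y,
      cross_y (k * x) (k * y) k = k ^+ 3 * V_at x y
    & cross_z (k * x) (k * y) k = k ^+ 3 * (x * U_at x y - y * V_at x y)].
Proof.
by split; rewrite /cross_x /cross_y /cross_z /field_x /field_y /field_z /U_at /V_at; ring.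
Qed.

Lemma singularP X Y Z : hpoint X Y Z != 0 ->
  reflect [/\ cross_x X Y Z = 0, cross_y X Y Z = 0 & cross_z X Y Z = 0]
          (field_at foliation (hpoint X Y Z) <= hpoint X Y Z)%MS.
Proof.
move=> r0; rewrite field_atE.
rewrite /cross_x /cross_y /cross_z.
apply: (iffP (sub_pointP _ _ _ r0)) => [[-> -> ->] | [E1 E2 E3]].
  by rewrite !subrr.
by split; apply: subr0_eq.
Qed.

(** V2 = 0 is linear in y, with leading coefficient x^2 + b x + e; putting its
    solution into (x^2 + b x + e)^2 U2 gives x times a polynomial of degree four
    in x, with leading coefficient C - a B + a^2.  So no abscissa is left for a
    point besides those of [s], and the abscissa determines the point. *)
Lemma affine_singular (s : seq (K * K)) x y :
  size s = 4%N -> uniq (map fst s) ->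
  {in s, forall q, [/\ U_at q.1 q.2 = 0, V_at q.1 q.2 = 0, q.1 != 0
                     & q.1 ^+ 2 + b * q.1 + e != 0]} ->
  e != 0 -> C - a * B + a ^+ 2 != 0 ->
  U_at x y = 0 -> V_at x y = 0 -> (x, y) \in (0, 0) :: s.
Proof.
move=> size_s uniq_s sP e0 lead0.
pose Q := Poly [:: C * e ^+ 2 - E * c * e;
  A * c ^+ 2 - (B * c + E * a) * e - E * c * b + 2 * C * b * e;
  2 * A * a * c + c ^+ 2 - B * a * e - (B * c + E * a) * b - E * c
    + C * (b ^+ 2 + 2 * e);
  A * a ^+ 2 + 2 * a * c - B * a * b - (B * c + E * a) + 2 * C * b;
  C - a * B + a ^+ 2].
have QE z t : V_at z t = 0 -> U_at z t = 0 -> z * Q.[z] = 0.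
  move=> Vzt Uzt.
  have yE : t * (z ^+ 2 + b * z + e) = - z * (a * z + c) + V_at z t by rewrite /V_at; ring.
  transitivity (z * (z * (z + A) * (a * z + c) ^+ 2
    - (B * z + E) * (a * z + c) * (z ^+ 2 + b * z + e) + C * (z ^+ 2 + b * z + e) ^+ 2)).
    by rewrite horner_Poly /=; ring.
  transitivity ((z + A) * (- z * (a * z + c)) ^+ 2
     + (B * z + E) * (- z * (a * z + c)) * (z ^+ 2 + b * z + e)
     + C * z * (z ^+ 2 + b * z + e) ^+ 2); first by ring.
  rewrite Vzt addr0 in yE; rewrite -yE.
  transitivity ((z ^+ 2 + b * z + e) ^+ 2 * U_at z t); first by rewrite /U_at; ring.
  by rewrite Uzt mulr0.
move=> Uxy Vxy; rewrite in_cons.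
have [x0 | x0] := eqVneq x 0.
  move: Vxy; rewrite x0 /V_at !(expr0n, mul0r, mulr0, add0r) /= => /eqP.
  by rewrite mulf_eq0 (negPf e0) /= => /eqP ->; rewrite eqxx.
have rootQ z : z \in x :: map fst s -> root Q z.
  rewrite in_cons => /predU1P[-> | /mapP[q sq ->]].
    by move/eqP: (QE _ _ Vxy Uxy); rewrite mulf_eq0 (negPf x0).
  have [Uq Vq q0 _] := sP q sq.
  by move/eqP: (QE _ _ Vq Uq); rewrite mulf_eq0 (negPf q0).
have Q0: Q != 0.
  apply: contraNneq lead0 => Q0.
  have <-: Q`_4 = C - a * B + a ^+ 2 by rewrite coef_Poly.
  by rewrite Q0 coef0.
have sx: x \in map fst s.
  apply/negPn/negP => sx.
  have:= @max_poly_roots _ Q (x :: map fst s) Q0.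
  rewrite /= sx uniq_s /= size_map size_s => /(_ _ isT).
  rewrite ltnNge (leq_trans (size_Poly _)) // => H.
  suff: false by [].
  apply: H; apply/andP; split; [|apply/allP=> z sz];
    by apply: rootQ; rewrite in_cons ?eqxx ?sz ?orbT.
have /mapP[q sq xq] := sx.
have [Uq Vq q0 qe] := sP q sq.
suff -> : y = q.2 by rewrite xq -surjective_pairing sq orbT.
apply: (mulIf qe); apply/eqP; rewrite -subr_eq0; apply/eqP.
transitivity (V_at x y - V_at q.1 q.2); last by rewrite Vxy Vq subrr.
by rewrite xq /V_at; ring.
Qed.

(** At infinity the cross product with the field is (- x y^2, x^2 y, _), which
    leaves only the two coordinate points. *)
Lemma singular_seven (s : seq (K * K)) :
  {in s, forall q, U_at q.1 q.2 = 0 /\ V_at q.1 q.2 = 0} ->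
  (forall x y, U_at x y = 0 -> V_at x y = 0 -> (x, y) \in (0, 0) :: s) ->
  singular_exactly_at foliation (seven s).
Proof.
move=> s0 sP r; rewrite [r]hpoint_eta.
move: (r 0 0) (r 0 1) (r 0 (inord 2)) => X Y Z r0.
split=> [/(singularP r0)[n1 n2 n3] | /(in_pointsP _ (seven_neq0 _))[w [k [sw k0 rw]]]].
  apply/(in_pointsP _ (seven_neq0 _)).
  have [Z0 | Z0] := eqVneq Z 0; last first.
    rewrite (apointZ _ _ Z0); eexists _, Z; split=> //.
    rewrite in_cons in_cons map_f ?orbT //.
    have Z3: Z ^+ 3 != 0 by rewrite expf_neq0.
    have [c1 c2 _] := cross_affine (X / Z) (Y / Z) Z.
    rewrite ![Z * (_ / Z)]mulrC !divfK // in c1 c2.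
    by apply: sP; [apply: (mulfI Z3); rewrite -[LHS]opprK -mulNr -c1 n1 oppr0
                  | apply: (mulfI Z3); rewrite -c2 n2]; rewrite mulr0.
  rewrite Z0 in n1 r0 *.
  have: X * Y ^+ 2 == 0.
    by rewrite -oppr_eq0 -n1 /cross_x /field_z; apply/eqP; ring.
  move: r0; rewrite hpoint_eq0 eqxx andbT negb_and mulf_eq0 expf_eq0 /=.
  have [-> /= Y0 _| X0 _ /= /eqP ->] := eqVneq X 0.
    by exists (hpoint 0 1 0), Y; rewrite !inE eqxx orbT hpointZ !mulr0 mulr1.
  by exists (hpoint 1 0 0), X; rewrite !inE eqxx hpointZ !mulr0 mulr1.
apply/(singularP r0); move: rw sw; rewrite 2!in_cons.
move=> rw /or3P[/eqP wE | /eqP wE | /mapP[q sq wE]];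
  rewrite {w}wE hpointZ in rw; case/hpoint_inj: rw => -> -> ->.
- by rewrite /cross_x /cross_y /cross_z /field_x /field_y /field_z; split; ring.
- by rewrite /cross_x /cross_y /cross_z /field_x /field_y /field_z; split; ring.
rewrite mulr1; have [-> -> ->] := cross_affine q.1 q.2 k.
have [-> ->]: U_at q.1 q.2 = 0 /\ V_at q.1 q.2 = 0.
  by move: sq; rewrite in_cons => /predU1P[-> | /s0 //]; rewrite /U_at /V_at /=; split; ring.
by rewrite !(mulr0, subrr).
Qed.

(** The tangent line to the foliation at (x : y : 1). *)
Definition leaf x y : 'M[K]_(2, 3) :=
  col_mx (hpoint x y 1) (hpoint (V_at x y) (U_at x y) 0).

Lemma mul_leaf (D : 'rV[K]_2) x y :
  D *m leaf x y =
  hpoint (D 0 0 * x + D 0 1 * V_at x y) (D 0 0 * y + D 0 1 * U_at x y) (D 0 0).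
Proof.
have DE : D = row_mx (D 0 0)%:M (D 0 1)%:M :> 'rV_(1 + 1).
  rewrite -[LHS](@hsubmxK _ 1 1 1) [lsubmx _]mx11_scalar [rsubmx _]mx11_scalar !mxE.
  by congr (row_mx (D _ _)%:M (D _ _)%:M); apply: val_inj.
rewrite [in LHS]DE (@mul_row_col _ 1 1 1) !mul_scalar_mx [X in _ + X]hpointZ hpoint_lin.
by rewrite mulr1 mulr0 addr0.
Qed.

Lemma sub_leafP x y X Y Z : V_at x y != 0 ->
  reflect (line_form x y X Y Z = 0) (hpoint X Y Z <= leaf x y)%MS.
Proof.
move=> V0; apply: (iffP submxP) => [[D] | on_leaf].
  rewrite mul_leaf => /hpoint_inj[-> -> ->].
  by rewrite /line_form; ring.
(* The third coordinate of the direction is 0, so Z is the weight of the point. *)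
exists (\row_i [:: Z; (X - x * Z) / V_at x y]`_i); rewrite mul_leaf !mxE /=.
congr (hpoint _ _ _); rewrite ?mulr0 ?addr0 ?mulr1 ?divfK //; first by ring.
apply: (mulfI V0); apply/eqP; rewrite -subr_eq0 -[X in _ == X]on_leaf /line_form.
by apply/eqP; field.
Qed.

Lemma rank_leaf x y : V_at x y != 0 -> \rank (leaf x y) = 2%N.
Proof.
move=> V0; apply/eqP; apply: inj_row_free => D.
rewrite mul_leaf => /eqP.
rewrite hpoint_eq0 => /and3P[/eqP E1 _ /eqP E2].
move/eqP: E1; rewrite E2 mul0r add0r mulf_eq0 (negPf V0) orbF => /eqP E1.
apply/rowP=> i; rewrite mxE; case: i => [[|[|i]] ilt] //.
  by rewrite -[RHS]E2; congr (D _ _); apply: val_inj.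
by rewrite -[RHS]E1; congr (D _ _); apply: val_inj.
Qed.

(** The second root of [tangency_form], in the chart z = 1. *)
Definition conj_point x y :=
  (x + shift x y / (T_at x y * U_at x y), y + shift x y / (T_at x y * V_at x y)).

Lemma tangent_leafP x y X Y Z :
  U_at x y != 0 -> V_at x y != 0 -> T_at x y != 0 -> hpoint X Y Z != 0 ->
  tangent_at foliation (leaf x y) (hpoint X Y Z)
  = in_points (hpoint X Y Z) [:: apoint (x, y); apoint (conj_point x y)].
Proof.
move=> U0 V0 T0 r0.
have s0: 0 \notin [:: apoint (x, y); apoint (conj_point x y)].
  by rewrite !inE !negb_or ![0 == _]eq_sym !apoint_neq0.
have onl t z : let X := z * x + t * V_at x y in let Y := z * y + t * U_at x y in
    tangent_at foliation (leaf x y) (hpoint X Y z)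
    = (t * (shift x y * z - T_at x y * U_at x y * V_at x y * t) == 0).
  rewrite /= /tangent_at field_atE -tangency_form.
  have -> : (hpoint (z * x + t * V_at x y) (z * y + t * U_at x y) z <= leaf x y)%MS.
    by apply/sub_leafP => //; rewrite /line_form; ring.
  by apply/(sub_leafP _ _ _ V0)/eqP.
apply/idP/(in_pointsP _ s0) => [tr | [w [k [sw k0 rw]]]].
  have /(sub_leafP _ _ _ V0) on_leaf : (hpoint X Y Z <= leaf x y)%MS by case/andP: tr.
  pose t := (X - x * Z) / V_at x y.
  have EX: X = Z * x + t * V_at x y by rewrite /t divfK //; ring.
  have EY: Y = Z * y + t * U_at x y.
    apply: (mulfI V0); apply/eqP; rewrite -subr_eq0 -[X in _ == X]on_leaf /line_form /t.
    by apply/eqP; field.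
  rewrite EX EY onl mulf_eq0 in tr; case/orP: tr => [/eqP t0 | ].
    exists (apoint (x, y)), Z; rewrite inE eqxx; split=> //.
      by apply: contraNneq r0 => Z0; rewrite EX EY t0 Z0 hpoint_eq0 !mul0r addr0 eqxx.
    by rewrite EX EY t0 hpointZ !mul0r !addr0 mulr1.
  rewrite subr_eq0 => /eqP kZ.
  have tE: t = shift x y * Z / (T_at x y * U_at x y * V_at x y).
    by rewrite kZ [X in X / _]mulrC mulfK // !mulf_neq0.
  exists (apoint (conj_point x y)), Z; rewrite !inE eqxx orbT; split=> //.
    apply: contraNneq r0 => Z0.
    by rewrite EX EY tE Z0 hpoint_eq0 !(mulr0, mul0r) addr0 eqxx.
  rewrite EX EY tE hpointZ mulr1; congr (hpoint _ _ _); rewrite /conj_point /=; field;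
   by rewrite ?T0 ?U0 ?V0.
rewrite rw; move: sw; rewrite !inE => /orP[] /eqP->; rewrite hpointZ mulr1 /=.
  by have:= onl 0 k; rewrite /= !mul0r !addr0 eqxx => ->.
have:= onl (shift x y * k / (T_at x y * U_at x y * V_at x y)) k.
rewrite [X in _ * X == 0](_ : _ = 0) ?mulr0 ?eqxx /=; last by field; rewrite ?T0 ?U0 ?V0.
by congr (is_true (tangent_at _ _ (hpoint _ _ _))) => /=; field; rewrite ?T0 ?U0 ?V0.
Qed.

(** The foliation at the second tangency point q is again tangent to the line, so
    (V2, U2) at q is l times (V2, U2) at p, and both points have the same tangent
    line.  Since p is a tangency point of it other than q, it is the one that
    [tangency_form] gives at q. *)
Lemma conj_pointK x y :
  let q := conj_point x y in
  U_at x y != 0 -> V_at x y != 0 -> T_at x y != 0 -> shift x y != 0 ->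
  U_at q.1 q.2 != 0 -> V_at q.1 q.2 != 0 -> T_at q.1 q.2 != 0 ->
  conj_point q.1 q.2 = (x, y).
Proof.
rewrite /=; set x' := x + _; set y' := y + _ => U0 V0 T0 K0 U'0 V'0 T'0.
pose k := shift x y / (T_at x y * U_at x y * V_at x y).
have Ex : x' = x + k * V_at x y by rewrite /x' /k; field; rewrite ?T0 ?U0 ?V0.
have Ey : y' = y + k * U_at x y by rewrite /y' /k; field; rewrite ?T0 ?U0 ?V0.
have k0 : k != 0 by rewrite !(mulf_neq0, invr_neq0).
have affv z w :
    field_x z w 1 = V_at z w - z ^+ 2 * w /\ field_y z w 1 = U_at z w - z * w ^+ 2.
  by rewrite /field_x /field_y /U_at /V_at; split; ring.
have para : U_at x y * V_at x' y' = V_at x y * U_at x' y'.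
  have := tangency_form x y 1 k.
  rewrite /= !mul1r -Ex -Ey mulr1.
  have -> : shift x y - T_at x y * U_at x y * V_at x y * k = 0.
    by rewrite /k; field; rewrite ?T0 ?U0 ?V0.
  rewrite mulr0; case: (affv x' y') => -> -> h.
  apply/eqP; rewrite eq_sym -subr_eq0; apply/eqP; rewrite -[RHS]h /line_form /field_z Ex Ey.
  move: (U_at (_ + _) _) (V_at (_ + _) _) => u' v'.
  ring.
pose l := U_at x' y' / U_at x y.
have l0 : l != 0 by rewrite mulf_neq0 ?invr_eq0.
have U'E : U_at x' y' = l * U_at x y by rewrite divfK.
have V'E : V_at x' y' = l * V_at x y.
  by apply: (mulfI U0); rewrite para U'E; ring.
(* The parameter of p on the line, seen from q. *)
have := tangency_form x' y' 1 (- k / l).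
have -> /= : 1 * x' + - k / l * V_at x' y' = x by rewrite V'E Ex; field.
have -> : 1 * y' + - k / l * U_at x' y' = y by rewrite U'E Ey; field.
have -> X Y Z : line_form x' y' X Y Z = l * line_form x y X Y Z.
  rewrite /line_form U'E V'E Ex Ey; ring.
have -> : line_form x y (field_x x y 1) (field_y x y 1) (field_z x y) = 0.
  by have := tangency_form x y 1 0; rewrite /= !mul1r !mul0r !addr0.
move/esym/eqP; rewrite mulr0 !mulf_eq0 oppr_eq0 invr_eq0 (negPf k0) (negPf l0) /=.
rewrite mulr1 subr_eq0 => /eqP k'E.
rewrite /conj_point k'E; congr pair.
  have -> : x = x' - k * V_at x y by rewrite Ex; ring.
  rewrite -[V_at x y](mulKf l0) -V'E; field; by rewrite ?T'0 ?U'0 ?V'0 ?l0.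
have -> : y = y' - k * U_at x y by rewrite Ey; ring.
rewrite -[U_at x y](mulKf l0) -U'E; field; by rewrite ?T'0 ?U'0 ?V'0 ?l0.
Qed.

(** * Cubics through the singular points *)

(** The coefficients of the cubic det (w, r, v r) in r, where w = (al, be, ga). *)
Definition net_coefs (al be ga : K) : seq (seq K) :=
  [:: [:: 0; e * be - E * al; - A * al - e * ga; 0];
      [:: c * be - C * al; b * be - B * al + (E - c) * ga; (A - b) * ga - al];
      [:: a * be + C * ga; be + (B - a) * ga];
      [:: 0]].

Definition net al be ga : dhomog 3 K 3 :=
  tform 3 (fun i j => (nth [::] (net_coefs al be ga) i)`_j).

Lemma feval_net al be ga X Y Z :
  feval (net al be ga) (hpoint X Y Z)
  = al * cross_x X Y Z + be * cross_y X Y Z + ga * cross_z X Y Z.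
Proof.
rewrite feval_form3 /= /cross_x /cross_y /cross_z /field_x /field_y /field_z; ring.
Qed.

Lemma net_lin k al be ga al' be' ga' :
  k *: net al be ga + net al' be' ga' = net (k * al + al') (k * be + be') (k * ga + ga').
Proof.
rewrite tform_lin; apply: eq_tform => i j.
by case: i => [|[|[|[|i]]]]; case: j => [|[|[|[|j]]]] //= _; ring.
Qed.

Lemma net0 : net 0 0 0 = 0.
Proof.
have <- : -1 *: net 0 0 0 + net 0 0 0 = 0 by rewrite scaleN1r addNr.
by rewrite net_lin mulr0 addr0.
Qed.

Lemma netZ k al be ga : k *: net al be ga = net (k * al) (k * be) (k * ga).
Proof. by rewrite -[LHS]addr0 -net0 net_lin !addr0. Qed.

(** The coefficient of x^2 in T; it is also the determinant, up to sign, that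
    recovers (al, be, ga) from the coefficients of x^2 y, x y^2 and x^2 z. *)
Hypothesis lead0 : C - a * B + a ^+ 2 != 0.

Lemma net_eq0 al be ga : net al be ga = 0 -> [/\ al = 0, be = 0 & ga = 0].
Proof.
rewrite -net0.
move=> H; have {}H := tform_inj H.
have := H 1 2 isT; have := H 2 1 isT; have := H 2 0 isT; rewrite /= !mulr0 !addr0 subr0.
move=> H20 H21 H12.
have ga0 : ga = 0.
  apply: (mulfI lead0).
  transitivity ((a * be + C * ga) - a * (be + (B - a) * ga)); first by ring.
  by rewrite H20 H21 !mulr0 subr0.
move: H21 H12; rewrite ga0 !mulr0 addr0 sub0r => -> /eqP.
by rewrite oppr_eq0 => /eqP ->.
Qed.

Variable s : seq (K * K).
Hypothesis s_sing : {in s, forall q, U_at q.1 q.2 = 0 /\ V_at q.1 q.2 = 0}.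
(** No conic through (1 : 0 : 0) and the origin passes through [s]. *)
Hypothesis s_conic : forall be ga de ep,
  {in s, forall q, be * q.2 ^+ 2 + ga * (q.1 * q.2) + de * q.1 + ep * q.2 = 0} ->
  [/\ be = 0, ga = 0, de = 0 & ep = 0].

Lemma vanishes_net al be ga : vanishes_on (seven s) (net al be ga).
Proof.
move=> r; rewrite 2!in_cons => /or3P[/eqP-> | /eqP-> | /mapP[q sq ->]];
  rewrite feval_net; try by rewrite /cross_x /cross_y /cross_z /field_x /field_y /field_z; ring.
have := cross_affine q.1 q.2 1.
rewrite !mul1r !expr1n => -[-> -> ->].
have [-> ->]: U_at q.1 q.2 = 0 /\ V_at q.1 q.2 = 0.
  by move: sq; rewrite in_cons => /predU1P[-> | /s_sing //]; rewrite /U_at /V_at /=; split; ring.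
by rewrite !(mulr0, subrr, addr0).
Qed.

(** Subtracting from a cubic [F] the element of the net with the same
    coefficients of x^2 y, x y^2 and x^2 z leaves z times a conic through
    (1 : 0 : 0), the origin and the points of [s]. *)
Lemma cubics_through_seven (F : dhomog 3 K 3) : vanishes_on (seven s) F ->
  exists al be ga, F = net al be ga.
Proof.
have [h ->] := tformP F => van_h.
pose ga := (h 2%N 0%N - a * h 2%N 1%N) / (C - a * B + a ^+ 2).
pose be := h 2%N 1%N - (B - a) * ga.
pose al := (A - b) * ga - h 1%N 2%N.
have h_seven r : r \in seven s -> feval (tform 3 h) r = 0 by apply: van_h.
have := h_seven (hpoint 1 0 0); have := h_seven (hpoint 0 1 0); have := h_seven (apoint (0, 0)).
rewrite !inE !eqxx ?orbT !feval_form3 !(expr0n, mulr0, mul0r, addr0, add0r, expr1n, mulr1) /=.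
move=> /(_ isT) h00 /(_ isT) h03 /(_ isT) h30.
have n20 : a * be + C * ga = h 2%N 0%N.
  rewrite /be; transitivity (a * h 2%N 1%N + ga * (C - a * B + a ^+ 2)); first by ring.
  by rewrite divfK // addrC subrK.
have [] := @s_conic (h 0%N 2%N - (- A * al - e * ga))
   (h 1%N 1%N - (b * be - B * al + (E - c) * ga))
   (h 1%N 0%N - (c * be - C * al)) (h 0%N 1%N - (e * be - E * al)).
  move=> q sq; have sq7 : apoint q \in seven s.
    by rewrite 2!in_cons map_f ?orbT // in_cons sq orbT.
  have Hh := h_seven _ sq7; have Hn := vanishes_net al be ga sq7.
  rewrite feval_form3 in Hh; rewrite feval_form3 /= in Hn.
  rewrite -[RHS](subrr 0) -[X in _ = X - _]Hh -[X in _ = _ - X]Hn h00 h03 h30 n20 /be /al; ring.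
move=> /subr0_eq h02 /subr0_eq h11 /subr0_eq h10 /subr0_eq h01.
exists al, be, ga; apply: eq_tform => i j.
case: i => [|[|[|[|i]]]]; case: j => [|[|[|[|j]]]] //= _; rewrite ?h02 ?h11 ?h10 ?h01 //.
- by rewrite /al; ring.
- by rewrite /be; ring.
Qed.

Lemma conj_point_neq x y :
  U_at x y != 0 -> T_at x y != 0 -> shift x y != 0 -> (x, y) != conj_point x y.
Proof.
move=> U0 T0 K0; rewrite xpair_eqE negb_and -subr_eq0 opprD addNKr oppr_eq0.
by rewrite !mulf_neq0 ?invr_eq0 ?mulf_neq0.
Qed.

Lemma exchanged_conj x y :
  U_at x y != 0 -> V_at x y != 0 -> T_at x y != 0 -> shift x y != 0 ->
  exchanged_tangency_points foliation (apoint (x, y)) (apoint (conj_point x y)).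
Proof.
move=> U0 V0 T0 K0; exists (leaf x y); split=> [||r].
- exact: rank_leaf.
- by rewrite /distinct_points /= !andbT same_apoint conj_point_neq.
- by rewrite [r]hpoint_eta; apply: tangent_leafP.
Qed.

Hypothesis sing : singular_exactly_at foliation (seven s).
Hypothesis s_distinct : distinct_points (seven s).

Lemma affine_not_base x y : U_at x y != 0 -> ~~ in_points (apoint (x, y)) (seven s).
Proof.
move=> U0; apply/negP => /(sing (apoint_neq0 _)).
move/(singularP (apoint_neq0 _)) => [n1 _ _].
have [c1 _ _] := cross_affine x y 1.
by rewrite !mul1r n1 expr1n mulN1r in c1; rewrite -oppr_eq0 -c1 eqxx in U0.
Qed.

(** The cross product n of r and v r is orthogonal to the point p and to the
    direction d exactly when n is a multiple of the line form.  If n is not zero,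
    then r and v r, being orthogonal to n, lie on the line. *)
Lemma net_leaf x y X Y Z : V_at x y != 0 -> hpoint X Y Z != 0 ->
  (feval (net x y 1) (hpoint X Y Z) = 0 /\
   feval (net (V_at x y) (U_at x y) 0) (hpoint X Y Z) = 0) <->
  (field_at foliation (hpoint X Y Z) <= hpoint X Y Z)%MS \/
  tangent_at foliation (leaf x y) (hpoint X Y Z).
Proof.
move=> V0 r0; rewrite !feval_net mul0r addr0 mul1r; split.
  case=> E1 E2.
  have n1 : cross_x X Y Z = - (cross_y X Y Z / V_at x y) * U_at x y.
    apply: (mulfI V0); apply/eqP; rewrite -subr_eq0 -[X in _ == X]E2; apply/eqP; field.
    by rewrite V0.
  have n3 : cross_z X Y Z = (cross_y X Y Z / V_at x y) * (x * U_at x y - y * V_at x y).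
    apply/eqP; rewrite -subr_eq0 -[X in _ == X]E1 n1; apply/eqP; field.
    by rewrite V0.
  have [n0 | n0] := eqVneq (cross_y X Y Z) 0.
    by left; apply/singularP => //; rewrite n1 n3 n0 !mul0r oppr0 mul0r.
  right; rewrite /tangent_at field_atE; apply/andP; split; apply/(sub_leafP _ _ _ V0).
    apply: (mulfI (mulf_neq0 n0 (invr_neq0 V0))); rewrite mulr0 /line_form.
    transitivity (X * (- (cross_y X Y Z / V_at x y) * U_at x y) + Y * cross_y X Y Z
      + Z * ((cross_y X Y Z / V_at x y) * (x * U_at x y - y * V_at x y))).
      by field; rewrite V0.
    by rewrite -n1 -n3 /cross_x /cross_y /cross_z; ring.
  apply: (mulfI (mulf_neq0 n0 (invr_neq0 V0))); rewrite mulr0 /line_form.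
  transitivity (field_x X Y Z * (- (cross_y X Y Z / V_at x y) * U_at x y)
    + field_y X Y Z * cross_y X Y Z
    + field_z X Y * ((cross_y X Y Z / V_at x y) * (x * U_at x y - y * V_at x y))).
    by field; rewrite V0.
  by rewrite -n1 -n3 /cross_x /cross_y /cross_z; ring.
case=> [/(singularP r0)[-> -> ->] | ]; first by rewrite !mulr0 !addr0.
rewrite /tangent_at field_atE => /andP[/(sub_leafP _ _ _ V0) E1 /(sub_leafP _ _ _ V0) E2].
have Yv X' Y' Z' : line_form x y X' Y' Z' = 0 ->
    Y' = Z' * y + (X' - Z' * x) / V_at x y * U_at x y.
  move=> El; apply: (mulfI V0); apply/eqP; rewrite -subr_eq0 -[X in _ == X]El /line_form.
  by apply/eqP; field; rewrite V0.
rewrite /cross_x /cross_y /cross_z (Yv _ _ _ E2); move: (field_x _ _ _) (field_z _ _) => X' Z'.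
rewrite (Yv _ _ _ E1).
by split; field; rewrite V0.
Qed.

(** The pencil is spanned by the cubics of the net that belong to the point itself
    and to the direction (V2 : U2 : 0) of the foliation there. *)
Lemma ninth_conj x y :
  let q := conj_point x y in
  U_at x y != 0 -> V_at x y != 0 -> T_at x y != 0 -> shift x y != 0 -> U_at q.1 q.2 != 0 ->
  ninth_base_point (seven s) (apoint (x, y)) (apoint q).
Proof.
move=> q U0 V0 T0 K0 Uq0.
pose G1 := net x y 1; pose G2 := net (V_at x y) (U_at x y) 0.
have WP (F : dhomog 3 K 3) : F \in <<[:: G1; G2]>>%VS <-> exists k l, F = k *: G1 + l *: G2.
  rewrite span_cons span_seq1; split.
    by case/memv_addP=> _ /vlineP[k ->] [_ /vlineP[l ->] ->]; exists k, l.
  by case=> k [l ->]; rewrite memv_add // memvZ // memv_line.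
have base k l X Y Z : feval (k *: G1 + l *: G2) (hpoint X Y Z)
    = k * feval G1 (hpoint X Y Z) + l * feval G2 (hpoint X Y Z).
  by rewrite (evalD (evalZ k erefl) (evalZ l erefl)).
exists <<[:: G1; G2]>>%VS; split.
- move=> F; rewrite WP; split.
    case=> k [l ->] r; rewrite in_cons => /predU1P[-> | rs].
      rewrite base; have [] := (net_leaf V0 (apoint_neq0 (x, y))).2; last first.
        by move=> -> ->; rewrite !mulr0 addr0.
      right; rewrite tangent_leafP ?apoint_neq0 //.
      by apply/hasP; exists (apoint (x, y)); rewrite ?mem_head ?submx_refl.
    by rewrite [r]hpoint_eta base -hpoint_eta !vanishes_net // !mulr0 addr0.
  move=> van; have [|al [be [ga FE]]] := @cubics_through_seven F.
    by move=> r rs; apply: van; rewrite in_cons rs orbT.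
  have := van _ (mem_head _ _); rewrite FE feval_net.
  have := cross_affine x y 1; rewrite !mul1r !expr1n => -[-> -> ->] E0.
  exists ga, ((al - ga * x) / V_at x y).
  rewrite [(_ / _) *: _]netZ net_lin mulr0 addr0 mulr1.
  congr (net _ _ _); first by rewrite divfK // addrC subrK.
  apply: (mulfI V0); apply/eqP; rewrite -subr_eq0 -[X in _ == X]E0; apply/eqP; field.
  by rewrite V0.
- suff /eqP -> : free [:: G1; G2] by [].
  rewrite free_cons span_seq1 seq1_free; apply/andP; split.
    apply/negP=> /vlineP[k G12].
    have := net_lin (- k) (V_at x y) (U_at x y) 0 x y 1.
    rewrite -/G1 -/G2 G12 scaleNr addNr => /esym/net_eq0[_ _ /eqP].
    by rewrite mulr0 add0r oner_eq0.
  by apply/eqP => /net_eq0[V00]; rewrite V00 eqxx in V0.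
- have allE w : all (fun v => ~~ (w == v)%MS) (seven s) = ~~ in_points w (seven s).
    by rewrite -all_predC.
  rewrite /distinct_points 2!pairwise_cons allE affine_not_base //.
  rewrite [pairwise _ _]s_distinct !andbT; apply/andP; split.
    by rewrite same_apoint eq_sym conj_point_neq.
  by have := affine_not_base Uq0; rewrite -allE -surjective_pairing.
- move=> r; rewrite [r]hpoint_eta.
  move: (r 0 0) (r 0 1) (r 0 (inord 2)) => X Y Z r0.
  have inE' : in_points (hpoint X Y Z) [:: apoint q, apoint (x, y) & seven s] =
     in_points (hpoint X Y Z) [:: apoint (x, y); apoint q]
     || in_points (hpoint X Y Z) (seven s).
    by rewrite /in_points /= orbF orbA [X in X || _]orbC.
  rewrite inE' -tangent_leafP //; split.
    move=> W0; have [] := (net_leaf V0 r0).1; last first.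
    + by move=> ->.
    + by move/(sing r0)=> ->; rewrite orbT.
    + split; apply: W0; apply/WP; [exists 1, 0 | exists 0, 1];
        by rewrite scale1r scale0r ?addr0 ?add0r.
  move=> tr F /WP[k [l ->]]; rewrite base.
  have [] := (net_leaf V0 r0).2; last by move=> -> ->; rewrite !mulr0 addr0.
  by case/orP: tr => [tr | /(sing r0)]; [right | left].
Qed.

End Foliation.

(** * General position *)

Section Subseqs.
Variable T : eqType.
Fixpoint subseqs k (s : seq T) : seq (seq T) :=
  match k, s with
  | 0, _ => [:: [::]]
  | k'.+1, [::] => [::]
  | k'.+1, x :: s' => map (cons x) (subseqs k' s') ++ subseqs k s'
  end.

Lemma subseqsP (t s : seq T) : subseq t s -> t \in subseqs (size t) s.
Proof.
elim: s t => [|x s IHs] [|y t] //= yts; rewrite mem_cat.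
case: eqP yts => [-> ts | _ yts]; first by apply/orP; left; apply: map_f; apply: IHs.
by apply/orP; right; apply: (IHs (y :: t)).
Qed.
End Subseqs.

Lemma subseqs_map (T T' : eqType) (f : T -> T') k s :
  subseqs k (map f s) = map (map f) (subseqs k s).
Proof.
elim: s k => [|x s IHs] [|k] //=.
by rewrite map_cat -!map_comp !IHs -map_comp.
Qed.

Section GeneralPosition.
Variable K : fieldType.
Implicit Types (u v w r : 'rV[K]_3).

Definition det3 u v w : K :=
  let X r := r 0 0 in let Y r := r 0 1 in let Z r := r 0 (inord 2) in
  X u * (Y v * Z w - Z v * Y w) - Y u * (X v * Z w - Z v * X w)
  + Z u * (X v * Y w - Y v * X w).

Lemma det3_inj u v w (al be ga : K) : det3 u v w != 0 ->
  (forall r, r \in [:: u; v; w] -> al * r 0 0 + be * r 0 1 + ga * r 0 (inord 2) = 0) ->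
  [/\ al = 0, be = 0 & ga = 0].
Proof.
move=> d0 H; have := H u; have := H v; have := H w; rewrite !inE !eqxx ?orbT.
move=> /(_ isT) Hw /(_ isT) Hv /(_ isT) Hu.
move: d0 Hu Hv Hw; rewrite /det3.
move: (u 0 0) (u 0 1) (u 0 (inord 2)) (v 0 0) (v 0 1) (v 0 (inord 2)).
move: (w 0 0) (w 0 1) (w 0 (inord 2)).
move=> w0 w1 w2 u0 u1 u2 v0 v1 v2 d0 Hu Hv Hw.
(* Cramer's rule: the combinations below are the columns of the adjugate. *)
split; apply: (mulfI d0); rewrite mulr0.
- transitivity ((al * u0 + be * u1 + ga * u2) * (v1 * w2 - v2 * w1)
   - (al * v0 + be * v1 + ga * v2) * (u1 * w2 - u2 * w1)
   + (al * w0 + be * w1 + ga * w2) * (u1 * v2 - u2 * v1)); first by ring.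
  by rewrite Hu Hv Hw; ring.
- transitivity (- (al * u0 + be * u1 + ga * u2) * (v0 * w2 - v2 * w0)
   + (al * v0 + be * v1 + ga * v2) * (u0 * w2 - u2 * w0)
   - (al * w0 + be * w1 + ga * w2) * (u0 * v2 - u2 * v0)); first by ring.
  by rewrite Hu Hv Hw; ring.
- transitivity ((al * u0 + be * u1 + ga * u2) * (v0 * w1 - v1 * w0)
   - (al * v0 + be * v1 + ga * v2) * (u0 * w1 - u1 * w0)
   + (al * w0 + be * w1 + ga * w2) * (u0 * v1 - u1 * v0)); first by ring.
  by rewrite Hu Hv Hw; ring.
Qed.

Lemma tform_eq0 d (c : nat -> nat -> K) :
  (forall i j, (i + j <= d)%N -> c i j = 0) -> tform d c = 0.
Proof.
move=> c0; have <- : -1 *: tform d c + tform d c = 0 by rewrite scaleN1r addNr.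
by rewrite tform_lin; apply: eq_tform => i j ijd; rewrite c0 // mulr0 addr0.
Qed.

Lemma not_collinear u v w : det3 u v w != 0 -> ~ on_curve_of_degree 1 [:: u; v; w].
Proof.
move=> d0 [F F0 Fuvw]; move: F0 Fuvw; have [h ->] := tformP F => /eqP F0 Fuvw.
apply: F0; have [|h10 h01 h00] := @det3_inj _ _ _ (h 1%N 0%N) (h 0%N 1%N) (h 0%N 0%N) d0.
  move=> r /Fuvw; rewrite {1}[r]hpoint_eta feval_form1 => <-; ring.
by apply: tform_eq0 => [[|[|i]]] [|[|j]].
Qed.

(** A conic through the unit point (1 : 1 : 1) and all but one of the
    coordinate points involves four monomials, and the unit point eliminates one
    of them; [row_omit_x], [row_omit_y] and [row_omit_z] are the values at
    (p.1 : p.2 : 1) of the other three minus the eliminated one, when (1 : 0 : 0),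
    (0 : 1 : 0) or (0 : 0 : 1) is the point left out.  If the unit point is left
    out, the monomials are x, y and xy.  The first two rows are also those of the
    linear systems for (a, b, c) and (A, B, C). *)
Definition row_omit_x (p : K * K) := hpoint (p.1 ^+ 2 - p.2) (p.1 * p.2 - p.2) (p.1 - p.2).
Definition row_omit_y (p : K * K) := hpoint (p.2 ^+ 2 - p.2) (p.1 * p.2 - p.2) (p.1 - p.2).
Definition row_omit_z (p : K * K) := hpoint (p.1 - 1) (p.2 - 1) (p.1 * p.2 - 1).
Definition row_omit_u (p : K * K) := hpoint p.1 p.2 (p.1 * p.2).

(** A conic through the three coordinate points and the unit point has only two
    free coefficients. *)
Definition minor_omit_m (p p' : K * K) : K :=
  (p.1 - p.1 * p.2) * (p'.2 - p'.1 * p'.2) - (p'.1 - p'.1 * p'.2) * (p.2 - p.1 * p.2).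

(** Leaving out one of seven points: either one of the four points of the standard
    frame, and then the other three and [p1], [p2], [p3] are on the conic, or one
    of the [p1], [p2], [p3]. *)
Lemma six_not_on_conic (p1 p2 p3 : K * K) :
  det3 (row_omit_x p1) (row_omit_x p2) (row_omit_x p3) != 0 ->
  det3 (row_omit_y p1) (row_omit_y p2) (row_omit_y p3) != 0 ->
  det3 (row_omit_z p1) (row_omit_z p2) (row_omit_z p3) != 0 ->
  det3 (row_omit_u p1) (row_omit_u p2) (row_omit_u p3) != 0 ->
  minor_omit_m p1 p2 != 0 -> minor_omit_m p1 p3 != 0 ->
  minor_omit_m p2 p3 != 0 ->
  forall t, subseq t (seven [:: (1, 1); p1; p2; p3]) -> size t = 6%N ->
  ~ on_curve_of_degree 2 t.
Proof.
move=> d1 d2 d3 d4 d12 d13 d23 t /subseqsP tP size_t.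
rewrite size_t in tP => -[F F0 Ft]; move: F0 Ft; have [h ->] := tformP F => /eqP F0 Ft.
apply: F0.
have ev r : r \in t -> feval (tform 2 h) r = 0 by apply: Ft.
have he1 : hpoint 1 0 0 \in t -> h 2%N 0%N = 0.
  by move/ev => <-; rewrite feval_form2; ring.
have he2 : hpoint 0 1 0 \in t -> h 0%N 2%N = 0.
  by move/ev => <-; rewrite feval_form2; ring.
have he3 : apoint (0, 0) \in t -> h 0%N 0%N = 0.
  by move/ev => <-; rewrite feval_form2 /=; ring.
have heu : apoint (1, 1) \in t ->
    h 0%N 0%N + h 0%N 1%N + h 0%N 2%N + h 1%N 0%N + h 1%N 1%N + h 2%N 0%N = 0.
  by move/ev => <-; rewrite feval_form2 /=; ring.
have hep p : apoint p \in t ->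
    h 0%N 0%N + h 0%N 1%N * p.2 + h 0%N 2%N * p.2 ^+ 2 + h 1%N 0%N * p.1
    + h 1%N 1%N * (p.1 * p.2) + h 2%N 0%N * p.1 ^+ 2 = 0.
  by move/ev => <-; rewrite feval_form2 /=; ring.
suff : [/\ h 0%N 0%N = 0, h 0%N 1%N = 0 & h 0%N 2%N = 0] /\
       [/\ h 1%N 0%N = 0, h 1%N 1%N = 0 & h 2%N 0%N = 0].
  by case=> [[h00 h01 h02] [h10 h11 h20]]; apply: tform_eq0 => [[|[|[|i]]]] [|[|[|j]]].
pose e1 : 'rV[K]_3 := hpoint 1 0 0; pose e2 : 'rV[K]_3 := hpoint 0 1 0.
pose o : 'rV[K]_3 := apoint (0, 0); pose u : 'rV[K]_3 := apoint (1, 1).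
have mem7 : [|| t == [:: e1; e2; o; u; apoint p1; apoint p2],
   t == [:: e1; e2; o; u; apoint p1; apoint p3],
   t == [:: e1; e2; o; u; apoint p2; apoint p3],
   t == [:: e1; e2; o; apoint p1; apoint p2; apoint p3],
   t == [:: e1; e2; u; apoint p1; apoint p2; apoint p3],
   t == [:: e1; o; u; apoint p1; apoint p2; apoint p3] |
   t == [:: e2; o; u; apoint p1; apoint p2; apoint p3]].
  by move: tP; rewrite !inE.
have two p p' : minor_omit_m p p' != 0 -> apoint p \in t -> apoint p' \in t ->
    hpoint 1 0 0 \in t -> hpoint 0 1 0 \in t -> apoint (0, 0) \in t -> apoint (1, 1) \in t ->
    [/\ h 0%N 0%N = 0, h 0%N 1%N = 0 & h 0%N 2%N = 0] /\
    [/\ h 1%N 0%N = 0, h 1%N 1%N = 0 & h 2%N 0%N = 0].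
  move=> d0 /hep hp /hep hp' /he1 h20 /he2 h02 /he3 h00 /heu.
  rewrite h00 h02 h20 !(add0r, addr0) !mul0r !(add0r, addr0) in hp hp' * => hu.
  have h11 : h 1%N 1%N = - (h 0%N 1%N + h 1%N 0%N) by apply/eqP; rewrite -addr_eq0 addrC hu.
  have h10 : h 1%N 0%N = 0.
    apply: (mulfI d0); rewrite mulr0 /minor_omit_m.
    transitivity ((h 0%N 1%N * p.2 + h 1%N 0%N * p.1 + h 1%N 1%N * (p.1 * p.2)) * (p'.2 - p'.1 * p'.2)
      - (h 0%N 1%N * p'.2 + h 1%N 0%N * p'.1 + h 1%N 1%N * (p'.1 * p'.2)) * (p.2 - p.1 * p.2)).
      by rewrite h11; ring.
    by rewrite hp hp'; ring.
  have h01 : h 0%N 1%N = 0.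
    apply: (mulfI d0); rewrite mulr0 /minor_omit_m.
    transitivity ((h 0%N 1%N * p'.2 + h 1%N 0%N * p'.1 + h 1%N 1%N * (p'.1 * p'.2)) * (p.1 - p.1 * p.2)
      - (h 0%N 1%N * p.2 + h 1%N 0%N * p.1 + h 1%N 1%N * (p.1 * p.2)) * (p'.1 - p'.1 * p'.2)).
      by rewrite h11; ring.
    by rewrite hp hp'; ring.
  by rewrite h11 h01 h10 addr0 oppr0.
have three (r : K * K -> 'rV[K]_3) : det3 (r p1) (r p2) (r p3) != 0 ->
    forall al be ga, (forall p, p \in [:: p1; p2; p3] ->
      al * r p 0 0 + be * r p 0 1 + ga * r p 0 (inord 2) = 0) ->
    [/\ al = 0, be = 0 & ga = 0].
  move=> d0 al be ga H; apply: (det3_inj d0) => v vin.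
  have /mapP[p pin ->] : v \in map r [:: p1; p2; p3] by [].
  exact: H.
case/or4P: mem7 => [/eqP tE|/eqP tE|/eqP tE|/or4P[] /eqP tE];
  try by [ apply: (two _ _ d12); rewrite tE !inE eqxx ?orbT
         | apply: (two _ _ d13); rewrite tE !inE eqxx ?orbT
         | apply: (two _ _ d23); rewrite tE !inE eqxx ?orbT ].
- have pt p : p \in [:: p1; p2; p3] -> apoint p \in t.
    by rewrite tE !inE => /or3P[] /eqP->; rewrite eqxx ?orbT.
  have h20 : h 2%N 0%N = 0 by apply: he1; rewrite tE !inE eqxx ?orbT.
  have h02 : h 0%N 2%N = 0 by apply: he2; rewrite tE !inE eqxx ?orbT.
  have h00 : h 0%N 0%N = 0 by apply: he3; rewrite tE !inE eqxx ?orbT.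
  have [|-> -> ->] := three row_omit_u d4 (h 1%N 0%N) (h 0%N 1%N) (h 1%N 1%N); last first.
    by rewrite h00 h02 h20.
  by move=> p /pt/hep; rewrite !hpointE h00 h02 h20 => <-; ring.
- have pt p : p \in [:: p1; p2; p3] -> apoint p \in t.
    by rewrite tE !inE => /or3P[] /eqP->; rewrite eqxx ?orbT.
  have h20 : h 2%N 0%N = 0 by apply: he1; rewrite tE !inE eqxx ?orbT.
  have h02 : h 0%N 2%N = 0 by apply: he2; rewrite tE !inE eqxx ?orbT.
  have hu : apoint (1, 1) \in t by rewrite tE !inE eqxx ?orbT.
  have := heu hu; rewrite h02 h20 !addr0.
  have [|-> -> ->] := three row_omit_z d3 (h 1%N 0%N) (h 0%N 1%N) (h 1%N 1%N); last first.
    by rewrite !addr0 => ->.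
  move=> p /pt/hep hp; have := congr2 (fun k l => k - l) hp (heu hu).
  by rewrite !hpointE h02 h20 subr0 => <-; ring.
- have pt p : p \in [:: p1; p2; p3] -> apoint p \in t.
    by rewrite tE !inE => /or3P[] /eqP->; rewrite eqxx ?orbT.
  have h20 : h 2%N 0%N = 0 by apply: he1; rewrite tE !inE eqxx ?orbT.
  have h00 : h 0%N 0%N = 0 by apply: he3; rewrite tE !inE eqxx ?orbT.
  have hu : apoint (1, 1) \in t by rewrite tE !inE eqxx ?orbT.
  have := heu hu; rewrite h00 h20 !addr0 !add0r.
  have [|-> -> ->] := three row_omit_y d2 (h 0%N 2%N) (h 1%N 1%N) (h 1%N 0%N); last first.
    by rewrite !addr0 => ->.
  move=> p /pt/hep hp; have := congr2 (fun k l => k - p.2 * l) hp (heu hu).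
  by rewrite !hpointE h00 h20 mulr0 subr0 => <-; ring.
- have pt p : p \in [:: p1; p2; p3] -> apoint p \in t.
    by rewrite tE !inE => /or3P[] /eqP->; rewrite eqxx ?orbT.
  have h02 : h 0%N 2%N = 0 by apply: he2; rewrite tE !inE eqxx ?orbT.
  have h00 : h 0%N 0%N = 0 by apply: he3; rewrite tE !inE eqxx ?orbT.
  have hu : apoint (1, 1) \in t by rewrite tE !inE eqxx ?orbT.
  have := heu hu; rewrite h02 h00 !addr0 !add0r.
  have [|-> -> ->] := three row_omit_x d1 (h 2%N 0%N) (h 1%N 1%N) (h 1%N 0%N); last first.
    by rewrite !addr0 => ->.
  move=> p /pt/hep hp; have := congr2 (fun k l => k - p.2 * l) hp (heu hu).
  by rewrite !hpointE h02 h00 mulr0 subr0 => <-; ring.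
Qed.

End GeneralPosition.

(** * The explicit map for a fixed non-degenerate triple *)

Ltac regularity := repeat first
  [ assumption | apply: regular_cst | apply: regular_entry | apply: regularX
  | apply: regularN | apply: regularD | apply: regularM ].

Section RegularFoliation.
Variable K : fieldType.
Variables (m n : nat) (M0 : 'M[K]_(m, n)).
Implicit Types f a b c e A B C E x y : 'M[K]_(m, n) -> K.
Local Notation regular := (regular M0).

Lemma regular_U A B C E x y :
  regular A -> regular B -> regular C -> regular E -> regular x -> regular y ->
  regular (fun M => U_at (A M) (B M) (C M) (E M) (x M) (y M)).
Proof. by move=> *; rewrite /U_at; regularity. Qed.

Lemma regular_V a b c e x y :
  regular a -> regular b -> regular c -> regular e -> regular x -> regular y ->
  regular (fun M => V_at (a M) (b M) (c M) (e M) (x M) (y M)).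
Proof. by move=> *; rewrite /V_at; regularity. Qed.

Section All.
Variables a b c e A B C E : 'M[K]_(m, n) -> K.
Hypotheses (ra : regular a) (rb : regular b) (rc : regular c) (re : regular e)
  (rA : regular A) (rB : regular B) (rC : regular C) (rE : regular E).

Lemma regular_T x y : regular x -> regular y ->
  regular (fun M => T_at (a M) (b M) (c M) (e M) (A M) (B M) (C M) (E M) (x M) (y M)).
Proof.
move=> rx ry; have rU := regular_U rA rB rC rE rx ry; have rV := regular_V ra rb rc re rx ry.
by rewrite /T_at; regularity.
Qed.

Lemma regular_shift x y : regular x -> regular y ->
  regular (fun M => shift (a M) (b M) (c M) (e M) (A M) (B M) (C M) (E M) (x M) (y M)).
Proof.
move=> rx ry; have rU := regular_U rA rB rC rE rx ry; have rV := regular_V ra rb rc re rx ry.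
by rewrite /shift /line_form; regularity.
Qed.
End All.
End RegularFoliation.

Section Generic.
Variable K : fieldType.

(** Nonzero exactly when [conj_point] is defined at (x, y), moves it, and is
    defined again at its image: one function that governs the genericity both of
    the moving point and, at a fixed (x, y), of the triple. *)
Definition conj_generic (a b c e A B C E : K) x y : K :=
  let q := conj_point a b c e A B C E x y in
  U_at A B C E x y * V_at a b c e x y * T_at a b c e A B C E x y * shift a b c e A B C E x y
  * (U_at A B C E q.1 q.2 * V_at a b c e q.1 q.2 * T_at a b c e A B C E q.1 q.2).

Lemma regular_conj_generic m n (M0 : 'M[K]_(m, n)) (a b c e A B C E x y : 'M[K]_(m, n) -> K) :
  let R := regular M0 in
  R a -> R b -> R c -> R e -> R A -> R B -> R C -> R E -> R x -> R y ->
  U_at (A M0) (B M0) (C M0) (E M0) (x M0) (y M0) != 0 ->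
  V_at (a M0) (b M0) (c M0) (e M0) (x M0) (y M0) != 0 ->
  T_at (a M0) (b M0) (c M0) (e M0) (A M0) (B M0) (C M0) (E M0) (x M0) (y M0) != 0 ->
  R (fun M => conj_generic (a M) (b M) (c M) (e M) (A M) (B M) (C M) (E M) (x M) (y M)).
Proof.
move=> R ra rb rc re rA rB rC rE rx ry U0 V0 T0.
have rU := regular_U rA rB rC rE rx ry; have rV := regular_V ra rb rc re rx ry.
have rT := regular_T ra rb rc re rA rB rC rE rx ry.
have rK := regular_shift ra rb rc re rA rB rC rE rx ry.
pose q M := conj_point (a M) (b M) (c M) (e M) (A M) (B M) (C M) (E M) (x M) (y M).
have rq1 : R (fun M => (q M).1).
  apply: regularD => //; apply: regularM => //; apply: regularV; first exact: regularM.
  by rewrite mulf_neq0.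
have rq2 : R (fun M => (q M).2).
  apply: regularD => //; apply: regularM => //; apply: regularV; first exact: regularM.
  by rewrite mulf_neq0.
have rUq := regular_U rA rB rC rE rq1 rq2; have rVq := regular_V ra rb rc re rq1 rq2.
have rTq := regular_T ra rb rc re rA rB rC rE rq1 rq2.
by rewrite /conj_generic; regularity.
Qed.

Definition line_generic (m : 'M[K]_(3, 2)) (t : seq nat) : bool :=
  let P i := nth 0 (seven_points m) (nth 0%N t i) in det3 (P 0%N) (P 1%N) (P 2%N) != 0.

(** Everything that must not vanish for the configuration, apart from the
    collinearity determinants: seven conic conditions, the two conditions on e and
    on the leading coefficient of the quartic, the abscissae being nonzero and
    distinct, and, for each of the four points of the chart other than the origin,
    the coefficient of y in V2. *)
Definition base_generic (p1 p2 p3 : K * K) (a b e B C : K) : seq K :=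
  [:: det3 (row_omit_x p1) (row_omit_x p2) (row_omit_x p3);
      det3 (row_omit_y p1) (row_omit_y p2) (row_omit_y p3);
      det3 (row_omit_z p1) (row_omit_z p2) (row_omit_z p3);
      det3 (row_omit_u p1) (row_omit_u p2) (row_omit_u p3);
      minor_omit_m p1 p2; minor_omit_m p1 p3; minor_omit_m p2 p3;
      e; C - a * B + a ^+ 2;
      p1.1; p2.1; p3.1; 1 - p1.1; 1 - p2.1; 1 - p3.1;
      p1.1 - p2.1; p1.1 - p3.1; p2.1 - p3.1;
      1 ^+ 2 + b * 1 + e; p1.1 ^+ 2 + b * p1.1 + e;
      p2.1 ^+ 2 + b * p2.1 + e; p3.1 ^+ 2 + b * p3.1 + e].

Lemma distinct_seven (s : seq (K * K)) : uniq ((0, 0) :: s) -> distinct_points (seven s).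
Proof.
move=> us.
have inf (x y : K) : all (fun v => ~~ (hpoint x y 0 == v)%MS) (map (@apoint K) ((0, 0) :: s)).
  apply/allP=> _ /mapP[q _ ->]; apply/same_pointP=> [|[k k0]]; first exact: apoint_neq0.
  by rewrite hpointZ mulr1 => /hpoint_inj[_ _ /esym/eqP]; rewrite (negPf k0).
rewrite /distinct_points 2!pairwise_cons; apply/and3P; split; last 1 first.
- rewrite pairwise_map; move: us; rewrite uniq_pairwise; apply: sub_pairwise => q q' /=.
  by rewrite -same_apoint.
- apply/andP; split; last exact: inf.
  apply/same_pointP=> [|[k _]]; first by rewrite hpoint_eq0 oner_eq0 andbF.
  by rewrite hpointZ mulr0 => /hpoint_inj[/eqP]; rewrite oner_eq0.
- exact: inf.
Qed.

Lemma seven_pointsE (m : 'M[K]_(3, 2)) : seven_points m =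
  seven [:: (1, 1); (m 0 0, m 0 1); (m 1 0, m 1 1); (m 2 0, m 2 1)].
Proof. by rewrite /seven_points /chart !mxE. Qed.

Section ExplicitMap.
Variables (m : 'M[K]_(3, 2)) (a b c A B C : K).
Let e := - (1 + a + b + c).
Let E := - (1 + A + B + C).
Let p1 := (m 0 0, m 0 1).
Let p2 := (m 1 0, m 1 1).
Let p3 := (m 2 0, m 2 1).
Let s := [:: (1, 1); p1; p2; p3].
Hypothesis sol : solves_system m a b c A B C.
Hypothesis base0 : all (fun k : K => k != 0) (base_generic p1 p2 p3 a b e B C).

Let s_sing : {in s, forall q, U_at A B C E q.1 q.2 = 0 /\ V_at a b c e q.1 q.2 = 0}.
Proof.
have HUV i : U_at A B C E (m i 0) (m i 1) = 0 /\ V_at a b c e (m i 0) (m i 1) = 0.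
  have [E1 E2] := sol i.
  by split; [move/eqP: E2 | move/eqP: E1]; rewrite -subr_eq0 => /eqP <-;
    rewrite /U_at /V_at /e /E; ring.
move=> q; rewrite !inE => /or4P[] /eqP-> //=.
by rewrite /U_at /V_at /e /E; split; ring.
Qed.

(** The conditions are referred to below by their position in the list. *)
Let nth0 i : (i < 22)%N -> nth 0 (base_generic p1 p2 p3 a b e B C) i != 0.
Proof. by move=> ilt; apply: (allP base0); apply: mem_nth. Qed.

Let s_uniq : uniq (map fst ((0, 0) :: s)).
Proof.
have := @nth0 9%N isT; have := @nth0 10%N isT; have := @nth0 11%N isT.
have := @nth0 12%N isT; have := @nth0 13%N isT; have := @nth0 14%N isT.
have := @nth0 15%N isT; have := @nth0 16%N isT; have := @nth0 17%N isT.
rewrite /= !inE !negb_or !subr_eq0 ![0 == _]eq_sym oner_eq0.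
by do 9! (move=> ->).
Qed.

(** The condition that makes the system for (A, B, C) uniquely solvable. *)
Let s_conic be ga de ep :
  {in s, forall q, be * q.2 ^+ 2 + ga * (q.1 * q.2) + de * q.1 + ep * q.2 = 0} ->
  [/\ be = 0, ga = 0, de = 0 & ep = 0].
Proof.
move=> H; have := H (1, 1) (mem_head _ _); rewrite /= expr1n !mulr1 => H1.
have D2 := @nth0 1%N isT.
have [|be0 ga0 de0] := det3_inj (al := be) (be := ga) (ga := de) D2.
  have Hr q : q \in [:: p1; p2; p3] ->
      be * (q.2 ^+ 2 - q.2) + ga * (q.1 * q.2 - q.2) + de * (q.1 - q.2) = 0.
    move=> qs; have Hq := H q; rewrite inE qs orbT in Hq.
    by have := congr2 (fun k l => k - q.2 * l) (Hq isT) H1; rewrite mulr0 subr0 => <-; ring.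
  move=> r; rewrite !inE => /or3P[] /eqP->; rewrite !hpointE;
    by apply: Hr; rewrite !inE eqxx ?orbT.
by move: H1; rewrite be0 ga0 de0 !add0r.
Qed.

Let sing : singular_exactly_at (foliation a b c e A B C E) (seven s).
Proof.
apply: singular_seven => // x y; apply: affine_singular => //.
- by move: s_uniq => /andP[].
- move=> q qs; have [-> ->] := s_sing qs; split=> //.
    have s0 : 0 \notin map fst s by case/andP: s_uniq.
    by apply: contraNneq s0 => <-; apply: map_f.
  move: qs; rewrite !inE => /or4P[] /eqP->;
    [exact: (@nth0 18%N isT) | exact: (@nth0 19%N isT)
    |exact: (@nth0 20%N isT) | exact: (@nth0 21%N isT)].
- exact: (@nth0 7%N isT).
- exact: (@nth0 8%N isT).
Qed.

Let s_distinct : distinct_points (seven s).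
Proof. by apply: distinct_seven; apply: map_uniq s_uniq. Qed.

Hypothesis lines0 : {in subseqs 3 (iota 0 7), forall t, line_generic m t}.

Lemma seven_general : general_position (seven_points m).
Proof.
split=> t.
  have -> : seven_points m = map (nth 0 (seven_points m)) (iota 0 7) by [].
  move/subseqsP; rewrite subseqs_map => tP size_t; move: tP; rewrite size_t.
  case/mapP=> u uP tE; have := lines0 uP; move: tE size_t; rewrite /line_generic => ->.
  by case: u {uP} => [|i [|j [|k [|]]]] // _; apply: not_collinear.
rewrite seven_pointsE; apply: six_not_on_conic.
- exact: (@nth0 0%N isT).
- exact: (@nth0 1%N isT).
- exact: (@nth0 2%N isT).
- exact: (@nth0 3%N isT).
- exact: (@nth0 4%N isT).
- exact: (@nth0 5%N isT).
- exact: (@nth0 6%N isT).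
Qed.

Let f := explicit_map a b c e A B C E.

Lemma explicit_mapE (p : 'rV[K]_2) :
  let x := p 0 0 in let y := p 0 1 in
  U_at A B C E x y != 0 -> V_at a b c e x y != 0 -> T_at a b c e A B C E x y != 0 ->
  defined_at f p /\ apply_map f p =
    \row_(i < 2) [:: (conj_point a b c e A B C E x y).1;
                     (conj_point a b c e A B C E x y).2]`_i.
Proof.
move=> x y U0 V0 T0.
have D1 := evalM (feval_T a b c e A B C E p) (feval_U2 A B C E p).
have D2 := evalM (feval_T a b c e A B C E p) (feval_V2 a b c e p).
split; first by rewrite /defined_at [feval _ p]D1 [feval _ p]D2 !mulf_neq0.
apply/rowP=> i; rewrite !mxE; congr nth; congr [:: _; _] => /=.
  by rewrite D1 feval_U1 -/x -/y; field; rewrite ?U0 ?T0.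
by rewrite D2 feval_V1 -/x -/y; field; rewrite ?V0 ?T0.
Qed.

(** A single point where [conj_generic] does not vanish makes it nonzero on a
    nonempty open set of points, over which all the claims hold. *)
Lemma explicit_map_Geiser (x0 y0 : K) : conj_generic a b c e A B C E x0 y0 != 0 ->
  is_associated_involution (seven_points m) f /\ is_Geiser_involution (seven_points m) f.
Proof.
move=> g0.
pose p0 : 'rV[K]_2 := \row_(i < 2) [:: x0; y0]`_i.
have nearP : near p0 (fun p : 'rV[K]_2 => conj_generic a b c e A B C E (p 0 0) (p 0 1) != 0).
  have E0 : p0 0 0 = x0 by rewrite mxE.
  have E1 : p0 0 1 = y0 by rewrite mxE.
  apply: regular_neq0; last by rewrite E0 E1.
  move: g0; rewrite mulf_eq0 negb_or => /andP[g0 _]; move: g0.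
  rewrite !mulf_eq0 !negb_or => /andP[/andP[/andP[U0 V0] T0] _].
  by apply: regular_conj_generic; rewrite ?E0 ?E1; regularity.
have nearG (Q : 'rV[K]_2 -> Prop) :
   (forall p : 'rV[K]_2, conj_generic a b c e A B C E (p 0 0) (p 0 1) != 0 -> Q p) ->
   generically Q.
  by move=> PQ; apply/near_generically/near_mono/nearP.
have genE (p : 'rV[K]_2) : conj_generic a b c e A B C E (p 0 0) (p 0 1) != 0 ->
  let x := p 0 0 in let y := p 0 1 in let q := conj_point a b c e A B C E x y in
  [/\ U_at A B C E x y != 0, V_at a b c e x y != 0, T_at a b c e A B C E x y != 0
    & shift a b c e A B C E x y != 0] /\
  [/\ U_at A B C E q.1 q.2 != 0, V_at a b c e q.1 q.2 != 0
    & T_at a b c e A B C E q.1 q.2 != 0].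
  by rewrite !mulf_eq0 !negb_or => /andP[/andP[/andP[/andP[? ?] ?] ?] /andP[/andP[? ?] ?]].
have chartE (p : 'rV[K]_2) : chart p = apoint (p 0 0, p 0 1) by [].
split.
  exists (foliation a b c e A B C E); split; first by rewrite seven_pointsE.
  apply: nearG => p /genE[[U0 V0 T0 K0] _].
  have [df ->] := explicit_mapE U0 V0 T0; split=> //.
  by rewrite !chartE !mxE -surjective_pairing; apply: exchanged_conj.
split=> //; first exact: seven_general.
  apply: nearG => p /genE[[U0 V0 T0 K0] [U'0 V'0 T'0]].
  have [df fE] := explicit_mapE U0 V0 T0.
  set q := conj_point _ _ _ _ _ _ _ _ _ _ in U'0 V'0 T'0.
  have q0 : apply_map f p 0 0 = q.1 by rewrite fE mxE.
  have q1 : apply_map f p 0 1 = q.2 by rewrite fE mxE.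
  rewrite -q0 -q1 in U'0 V'0 T'0; have [df' ->] := explicit_mapE U'0 V'0 T'0.
  split=> //; rewrite q0 q1 conj_pointK -?q0 -?q1 //=.
  by apply/rowP=> i; rewrite mxE; case: i => [[|[|i]] ilt] //=; congr (p _ _); apply: val_inj.
apply: nearG => p /genE[[U0 V0 T0 K0] [U'0 _ _]].
have [df ->] := explicit_mapE U0 V0 T0; split=> //.
rewrite !chartE !mxE -surjective_pairing seven_pointsE; apply: ninth_conj => //.
exact: (@nth0 8%N isT).
Qed.

End ExplicitMap.
End Generic.

(** * Transfer along field morphisms *)

Section Morphisms.
Variables (F K : fieldType) (f : {rmorphism F -> K}).

(** Like [evalD], these build the preimage of an expression step by step. *)
Lemma imageD x y x' y' : x = f x' -> y = f y' -> x + y = f (x' + y').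
Proof. by move=> -> ->; rewrite rmorphD. Qed.

Lemma imageN x x' : x = f x' -> - x = f (- x').
Proof. by move=> ->; rewrite rmorphN. Qed.

Lemma imageM x y x' y' : x = f x' -> y = f y' -> x * y = f (x' * y').
Proof. by move=> -> ->; rewrite rmorphM. Qed.

Lemma imageXn n x x' : x = f x' -> x ^+ n = f (x' ^+ n).
Proof. by move=> ->; rewrite rmorphXn. Qed.

Lemma imageV x x' : x = f x' -> x^-1 = f x'^-1.
Proof. by move=> ->; rewrite fmorphV. Qed.

Lemma image_nat n : n%:R = f n%:R.
Proof. by rewrite rmorph_nat. Qed.

Lemma image1 : 1 = f 1.
Proof. by rewrite rmorph1. Qed.

End Morphisms.

Ltac image := repeat lazymatch goal with
  | |- _ + _ = _ => apply: imageD
  | |- - _ = _ => apply: imageN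
  | |- _ * _ = _ => apply: imageM
  | |- _ ^+ _ = _ => apply: imageXn
  | |- _^-1 = _ => apply: imageV
  | |- 1 = _ => apply: image1
  | |- _%:R = _ => apply: image_nat
  | |- ?g _ = _ => reflexivity
  end.

Section GenericityMorphisms.
Variables (F K : fieldType) (f : {rmorphism F -> K}).

Lemma image_det3 X1 Y1 Z1 X2 Y2 Z2 X3 Y3 Z3 x1 y1 z1 x2 y2 z2 x3 y3 z3 :
  X1 = f x1 -> Y1 = f y1 -> Z1 = f z1 -> X2 = f x2 -> Y2 = f y2 -> Z2 = f z2 ->
  X3 = f x3 -> Y3 = f y3 -> Z3 = f z3 ->
  det3 (hpoint X1 Y1 Z1) (hpoint X2 Y2 Z2) (hpoint X3 Y3 Z3)
  = f (det3 (hpoint x1 y1 z1) (hpoint x2 y2 z2) (hpoint x3 y3 z3)).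
Proof. by move=> -> -> -> -> -> -> -> -> ->; rewrite /det3 !hpointE; image. Qed.

Lemma base_generic_map p1 p2 p3 a b e B C :
  let g (p : F * F) := (f p.1, f p.2) in
  base_generic (g p1) (g p2) (g p3) (f a) (f b) (f e) (f B) (f C)
  = map f (base_generic p1 p2 p3 a b e B C).
Proof.
rewrite /base_generic [map _ _]/=.
rewrite /row_omit_x /row_omit_y /row_omit_z /row_omit_u /minor_omit_m /=.
by do !congr (_ :: _); first [apply: image_det3; image | image].
Qed.

Lemma image_U A B C E x y X Y : X = f x -> Y = f y ->
  U_at (f A) (f B) (f C) (f E) X Y = f (U_at A B C E x y).
Proof. by move=> -> ->; rewrite /U_at; image. Qed.

Lemma image_V a b c e x y X Y : X = f x -> Y = f y ->
  V_at (f a) (f b) (f c) (f e) X Y = f (V_at a b c e x y).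
Proof. by move=> -> ->; rewrite /V_at; image. Qed.

Lemma image_T a b c e A B C E x y X Y : X = f x -> Y = f y ->
  T_at (f a) (f b) (f c) (f e) (f A) (f B) (f C) (f E) X Y = f (T_at a b c e A B C E x y).
Proof. by move=> -> ->; rewrite /T_at; image; first [exact: image_U | exact: image_V]. Qed.

Lemma image_shift a b c e A B C E x y X Y : X = f x -> Y = f y ->
  shift (f a) (f b) (f c) (f e) (f A) (f B) (f C) (f E) X Y = f (shift a b c e A B C E x y).
Proof.
by move=> -> ->; rewrite /shift /line_form; image; first [exact: image_U | exact: image_V].
Qed.

Lemma image_conj_generic a b c e A B C E x y :
  conj_generic (f a) (f b) (f c) (f e) (f A) (f B) (f C) (f E) (f x) (f y)
  = f (conj_generic a b c e A B C E x y).
Proof.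
have im1 : (conj_point (f a) (f b) (f c) (f e) (f A) (f B) (f C) (f E) (f x) (f y)).1
           = f (conj_point a b c e A B C E x y).1.
  by rewrite /conj_point /=; image; first [exact: image_U | exact: image_T | exact: image_shift].
have im2 : (conj_point (f a) (f b) (f c) (f e) (f A) (f B) (f C) (f E) (f x) (f y)).2
           = f (conj_point a b c e A B C E x y).2.
  by rewrite /conj_point /=; image; first [exact: image_V | exact: image_T | exact: image_shift].
rewrite /conj_generic !rmorphM; congr (_ * _ * _ * _ * (_ * _ * _));
  first [exact: image_U | exact: image_V | exact: image_T | exact: image_shift].
Qed.
End GenericityMorphisms.

(** * Genericity of the triple, checked at one rational triple *)

Section RegularSolution.
Variable K : fieldType.
Variables (M0 : 'M[K]_(3, 2)).
Implicit Type m : 'M[K]_(3, 2).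

Lemma regular_eq (phi psi : 'M[K]_(3, 2) -> K) :
  phi =1 psi -> regular M0 phi -> regular M0 psi.
Proof.
by move=> E [g [h [h0 gh]]]; exists g, h; split=> // M hM; rewrite -E gh.
Qed.

Lemma regular_det3 (x1 y1 z1 x2 y2 z2 x3 y3 z3 : 'M[K]_(3, 2) -> K) :
  let R := regular M0 in
  R x1 -> R y1 -> R z1 -> R x2 -> R y2 -> R z2 -> R x3 -> R y3 -> R z3 ->
  R (fun M => det3 (hpoint (x1 M) (y1 M) (z1 M)) (hpoint (x2 M) (y2 M) (z2 M))
                   (hpoint (x3 M) (y3 M) (z3 M))).
Proof.
move=> R *; apply: (@regular_eq (fun M => x1 M * (y2 M * z3 M - z2 M * y3 M)
  - y1 M * (x2 M * z3 M - z2 M * x3 M) + z1 M * (x2 M * y3 M - y2 M * x3 M))).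
  by move=> M; rewrite /det3 !hpointE.
by regularity.
Qed.

(** By Cramer's rule the solution is a regular function of the triple, and the
    only solution wherever the determinant does not vanish. *)
Lemma regular_cramer (al be ga k : 'I_3 -> 'M[K]_(3, 2) -> K) :
  let row i m := hpoint (al i m) (be i m) (ga i m) in
  let det m := det3 (row 0 m) (row 1 m) (row 2 m) in
  (forall i, [/\ regular M0 (al i), regular M0 (be i), regular M0 (ga i)
               & regular M0 (k i)]) ->
  det M0 != 0 ->
  exists a b c : 'M[K]_(3, 2) -> K,
    [/\ regular M0 a, regular M0 b & regular M0 c] /\
    forall m a' b' c', det m != 0 ->
      (forall i, al i m * a' + be i m * b' + ga i m * c' = k i m) ->
      [/\ a' = a m, b' = b m & c' = c m].
Proof.
move=> row det reg d0.
have [al0 be0 ga0 k0] := reg 0; have [al1 be1 ga1 k1] := reg 1.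
have [al2 be2 ga2 k2] := reg 2.
have rdet : regular M0 det by apply: regular_det3.
have quo num : regular M0 num -> regular M0 (fun m => num m / det m).
  by move=> rn; apply: regularM => //; apply: regularV.
pose da m := det3 (hpoint (k 0 m) (be 0 m) (ga 0 m)) (hpoint (k 1 m) (be 1 m) (ga 1 m))
  (hpoint (k 2 m) (be 2 m) (ga 2 m)).
pose db m := det3 (hpoint (al 0 m) (k 0 m) (ga 0 m)) (hpoint (al 1 m) (k 1 m) (ga 1 m))
  (hpoint (al 2 m) (k 2 m) (ga 2 m)).
pose dc m := det3 (hpoint (al 0 m) (be 0 m) (k 0 m)) (hpoint (al 1 m) (be 1 m) (k 1 m))
  (hpoint (al 2 m) (be 2 m) (k 2 m)).
exists (fun m => da m / det m), (fun m => db m / det m), (fun m => dc m / det m).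
split; first by split; apply: quo; apply: regular_det3.
move=> m a b c dm sol.
have e0 := sol 0; have e1 := sol 1; have e2 := sol 2.
by split; apply: (mulIf dm); rewrite divfK // /det /da /db /dc /row /det3 !hpointE;
  rewrite -e0 -e1 -e2; ring.
Qed.

Lemma regular_seven i : (i < 7)%N -> exists x y z : 'M[K]_(3, 2) -> K,
  [/\ regular M0 x, regular M0 y & regular M0 z] /\
  forall m, nth 0 (seven_points m) i = hpoint (x m) (y m) (z m).
Proof.
have known (x y z : 'M[K]_(3, 2) -> K) : regular M0 x -> regular M0 y -> regular M0 z ->
    (forall m, nth 0 (seven_points m) i = hpoint (x m) (y m) (z m)) ->
  exists x y z : 'M[K]_(3, 2) -> K,
  [/\ regular M0 x, regular M0 y & regular M0 z] /\
  forall m, nth 0 (seven_points m) i = hpoint (x m) (y m) (z m).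
  by move=> rx ry rz E; exists x, y, z.
case: i known => [|[|[|[|[|[|[|i]]]]]]] // known _;
  [apply: (known (fun=> 1) (fun=> 0) (fun=> 0)) | apply: (known (fun=> 0) (fun=> 1) (fun=> 0))
  |apply: (known (fun=> 0) (fun=> 0) (fun=> 1)) | apply: (known (fun=> 1) (fun=> 1) (fun=> 1))
  |apply: (known (fun m => m 0 0) (fun m => m 0 1) (fun=> 1))
  |apply: (known (fun m => m 1 0) (fun m => m 1 1) (fun=> 1))
  |apply: (known (fun m => m 2 0) (fun m => m 2 1) (fun=> 1))];
  try exact: regular_cst; try exact: regular_entry; move=> m; rewrite seven_pointsE //.
Qed.
End RegularSolution.

Section Example.
Variable K : numFieldType.
Local Notation f := (@ratr K).

(** The triple (-3, -1), (2, -3), (4, -2), for which all conditions hold and the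
    two linear systems have solutions of small height. *)
Definition wit_coord (i j : nat) : rat :=
  nth 0 (nth [::] [:: [:: -3; -1]; [:: 2; -3]; [:: 4; -2]] i) j.
Definition wit : 'M[K]_(3, 2) := \matrix_(i, j) f (wit_coord i j).

Lemma witE i j : wit i j = f (wit_coord i j).
Proof. by rewrite mxE. Qed.

(** The solutions of the two linear systems for this triple. *)
Definition wit_a : rat := 17%:Q / 12%:Q.
Definition wit_b : rat := - (7%:Q / 3%:Q).
Definition wit_c : rat := - (19%:Q / 12%:Q).
Definition wit_A : rat := - (2%:Q / 3%:Q).
Definition wit_B : rat := - (2%:Q / 3%:Q).
Definition wit_C : rat := - 3%:Q.
Definition wit_e := - (1 + wit_a + wit_b + wit_c).
Definition wit_E := - (1 + wit_A + wit_B + wit_C).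

Definition wit_p1 := (wit_coord 0 0, wit_coord 0 1).
Definition wit_p2 := (wit_coord 1 0, wit_coord 1 1).
Definition wit_p3 := (wit_coord 2 0, wit_coord 2 1).

Lemma base_generic_wit_rat : all (fun k : rat => k != 0)
  (base_generic wit_p1 wit_p2 wit_p3 wit_a wit_b wit_e wit_B wit_C).
Proof.
rewrite /base_generic /row_omit_x /row_omit_y /row_omit_z /row_omit_u.
(* The row vectors do not compute, so their entries are extracted first. *)
by rewrite /det3 !hpointE; vm_compute.
Qed.

(** The involution sends (-2, -1) to (-1, 0). *)
Lemma conj_generic_wit :
  conj_generic wit_a wit_b wit_c wit_e wit_A wit_B wit_C wit_E (-2) (-1) != 0.
Proof. by vm_compute. Qed.

Lemma base_generic_wit : all (fun k : K => k != 0)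
  (base_generic (wit 0 0, wit 0 1) (wit 1 0, wit 1 1) (wit 2 0, wit 2 1)
     (f wit_a) (f wit_b) (f wit_e) (f wit_B) (f wit_C)).
Proof.
rewrite !witE (base_generic_map (@ratr K) wit_p1 wit_p2 wit_p3) all_map.
rewrite (@eq_all _ _ (fun k => k != 0)) ?base_generic_wit_rat // => k.
by rewrite /= fmorph_eq0.
Qed.

Lemma base_generic_wit_nth i : (i < 22)%N -> nth 0
  (base_generic (wit 0 0, wit 0 1) (wit 1 0, wit 1 1) (wit 2 0, wit 2 1)
     (f wit_a) (f wit_b) (f wit_e) (f wit_B) (f wit_C)) i != 0.
Proof. by move=> i22; apply: (allP base_generic_wit); apply: mem_nth. Qed.

Definition wit_seven : seq (rat * rat * rat) :=
  [:: (1, 0, 0); (0, 1, 0); (0, 0, 1); (1, 1, 1); (wit_p1, 1); (wit_p2, 1); (wit_p3, 1)].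

Lemma line_generic_wit : {in subseqs 3 (iota 0 7), forall t, line_generic wit t}.
Proof.
have sevenE i : (i < 7)%N -> nth 0 (seven_points wit) i =
    let p := nth (0, 0, 0) wit_seven i in hpoint (f p.1.1) (f p.1.2) (f p.2).
  rewrite seven_pointsE !witE.
  by case: i => [|[|[|[|[|[|[|i]]]]]]] //= _; rewrite ?rmorph1 ?rmorph0.
pose d t := let P i := nth (0, 0, 0) wit_seven (nth 0%N t i) in
  let p := P 0%N in let q := P 1%N in let r := P 2%N in
  p.1.1 * (q.1.2 * r.2 - q.2 * r.1.2) - p.1.2 * (q.1.1 * r.2 - q.2 * r.1.1)
  + p.2 * (q.1.1 * r.1.2 - q.1.2 * r.1.1).
have dP : all (fun t => (size t == 3%N) && all (fun i => i < 7)%N t && (d t != 0))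
    (subseqs 3 (iota 0 7)).
  by vm_compute.
move=> t /(allP dP) /andP[/andP[/eqP st /allP t7] dt].
have t7' i : (i < 3)%N -> (nth 0%N t i < 7)%N.
  by move=> i3; apply: t7; apply: mem_nth; rewrite st.
rewrite /line_generic.
rewrite (sevenE _ (t7' 0%N isT)) (sevenE _ (t7' 1%N isT)) (sevenE _ (t7' 2%N isT)).
cbv zeta; rewrite (image_det3 (f := @ratr K) erefl erefl erefl erefl erefl erefl erefl erefl erefl).
by rewrite fmorph_eq0 /det3 !hpointE.
Qed.

Lemma near_line_generic t : t \in subseqs 3 (iota 0 7) -> near wit (fun m => line_generic m t).
Proof.
move=> tP; apply: regular_neq0; last exact: line_generic_wit.
have t7 i : (i < 3)%N -> (nth 0%N t i < 7)%N.
  have : all (fun t => (nth 0 t 0 < 7) && (nth 0 t 1 < 7) && (nth 0 t 2 < 7))%N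
    (subseqs 3 (iota 0 7)) by [].
  by move/allP/(_ t tP) => /andP[/andP[h0 h1] h2]; case: i => [|[|[|]]].
have [x1 [y1 [z1 [[rx1 ry1 rz1] E1]]]] := @regular_seven _ wit _ (t7 0%N isT).
have [x2 [y2 [z2 [[rx2 ry2 rz2] E2]]]] := @regular_seven _ wit _ (t7 1%N isT).
have [x3 [y3 [z3 [[rx3 ry3 rz3] E3]]]] := @regular_seven _ wit _ (t7 2%N isT).
apply: regular_eq (regular_det3 rx1 ry1 rz1 rx2 ry2 rz2 rx3 ry3 rz3) => m.
by rewrite E1 E2 E3.
Qed.

(** Near the chosen triple every solution of the two systems is the one given by
    Cramer's rule, so the conditions, which also involve the solution, are values
    of regular functions of the triple. *)
Lemma near_solution : near wit (fun m => forall a b c A B C, solves_system m a b c A B C ->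
  let e := - (1 + a + b + c) in let E := - (1 + A + B + C) in
  all (fun k : K => k != 0) (base_generic (m 0 0, m 0 1) (m 1 0, m 1 1) (m 2 0, m 2 1) a b e B C)
  /\ conj_generic a b c e A B C E (f (- 2)) (f (- 1)) != 0).
Proof.
have [||a [b [c [[ra rb rc] solP]]]] := @regular_cramer _ wit
  (fun i m => m i 0 ^+ 2 - m i 1) (fun i m => m i 0 * m i 1 - m i 1)
  (fun i m => m i 0 - m i 1) (fun i m => m i 1 - m i 0 ^+ 2 * m i 1).
- by move=> i; split; regularity.
- exact: (@base_generic_wit_nth 0%N isT).
have [||A [B [C [[rA rB rC] SOLP]]]] := @regular_cramer _ wit
  (fun i m => m i 1 ^+ 2 - m i 1) (fun i m => m i 0 * m i 1 - m i 1)
  (fun i m => m i 0 - m i 1) (fun i m => m i 1 - m i 0 * m i 1 ^+ 2).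
- by move=> i; split; regularity.
- exact: (@base_generic_wit_nth 1%N isT).
have [||Ea Eb Ec] := solP wit (f wit_a) (f wit_b) (f wit_c).
- exact: (@base_generic_wit_nth 0%N isT).
- move=> i; rewrite !witE.
  transitivity (f ((wit_coord i 0 ^+ 2 - wit_coord i 1) * wit_a
    + (wit_coord i 0 * wit_coord i 1 - wit_coord i 1) * wit_b
    + (wit_coord i 0 - wit_coord i 1) * wit_c)).
    by image.
  transitivity (f (wit_coord i 1 - wit_coord i 0 ^+ 2 * wit_coord i 1)); last by symmetry; image.
  by congr (f _); case: i => [[|[|[|i]]] ilt] //; vm_compute.
have [||EA EB EC] := SOLP wit (f wit_A) (f wit_B) (f wit_C).
- exact: (@base_generic_wit_nth 1%N isT).
- move=> i; rewrite !witE.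
  transitivity (f ((wit_coord i 1 ^+ 2 - wit_coord i 1) * wit_A
    + (wit_coord i 0 * wit_coord i 1 - wit_coord i 1) * wit_B
    + (wit_coord i 0 - wit_coord i 1) * wit_C)).
    by image.
  transitivity (f (wit_coord i 1 - wit_coord i 0 * wit_coord i 1 ^+ 2)); last by symmetry; image.
  by congr (f _); case: i => [[|[|[|i]]] ilt] //; vm_compute.
pose e m := - (1 + a m + b m + c m); pose E m := - (1 + A m + B m + C m).
have re : regular wit e by rewrite /e; regularity.
have rE : regular wit E by rewrite /E; regularity.
have Ee : e wit = f wit_e by rewrite /e -Ea -Eb -Ec; image.
have EE : E wit = f wit_E by rewrite /E -EA -EB -EC; image.
pose L (m : 'M[K]_(3, 2)) :=
  base_generic (m 0 0, m 0 1) (m 1 0, m 1 1) (m 2 0, m 2 1) (a m) (b m) (e m) (B m) (C m).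
have nearL : near wit (fun m => forall i, i \in iota 0 22 -> nth 0 (L m) i != 0).
  apply: near_all => i i22; apply: regular_neq0; last first.
    by rewrite /L -Ea -Eb Ee -EB -EC; apply: base_generic_wit_nth; rewrite mem_iota in i22.
  move: i22; rewrite mem_iota /=.
  case: i => [|[|[|[|[|[|[|[|[|[|[|[|[|[|[|[|[|[|[|[|[|[|i]]]]]]]]]]]]]]]]]]]]]] // _;
    rewrite /L /base_generic;
    rewrite /row_omit_x /row_omit_y /row_omit_z /row_omit_u /minor_omit_m /=;
    by [apply: regular_det3; regularity | regularity].
pose G (m : 'M[K]_(3, 2)) := conj_generic (a m) (b m) (c m) (e m)
  (A m) (B m) (C m) (E m) (f (-2)) (f (-1)).
have nearC : near wit (fun m => G m != 0).
  have g0 : G wit != 0.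
    by rewrite /G -Ea -Eb -Ec Ee -EA -EB -EC EE image_conj_generic fmorph_eq0 conj_generic_wit.
  apply: regular_neq0 => //.
  move: g0; rewrite mulf_eq0 negb_or => /andP[g0 _]; move: g0.
  rewrite !mulf_eq0 !negb_or => /andP[/andP[/andP[U0 V0] T0] _].
  by apply: regular_conj_generic => //; regularity.
apply: near_mono (near_and nearL nearC) => m [Lm Cm] a' b' c' A' B' C' sol.
have [|i|Ea' Eb' Ec'] := solP m a' b' c'.
- exact: (Lm 0%N).
- by have [] := sol i.
have [|i|EA' EB' EC'] := SOLP m A' B' C'.
- exact: (Lm 1%N).
- by have [] := sol i.
rewrite Ea' Eb' Ec' EA' EB' EC'; split=> //.
by apply/(all_nthP 0) => i i22; apply: Lm; rewrite mem_iota.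
Qed.

Theorem generic_Geiser : generically (fun m : 'M[K]_(3, 2) =>
  forall a b c A B C : K, solves_system m a b c A B C ->
    let e := - (1 + a + b + c) in
    let E := - (1 + A + B + C) in
    let f := explicit_map a b c e A B C E in
    is_associated_involution (seven_points m) f /\
    is_Geiser_involution (seven_points m) f).
Proof.
apply: near_generically.
apply: near_mono (near_and near_solution (near_all near_line_generic)) => m [base lines].
move=> a b c A B C sol; have [base0 g0] := base _ _ _ _ _ _ sol.
exact: explicit_map_Geiser sol base0 lines _ _ g0.
Qed.

End Example.

Theorem proposition3p7 (R : realType) :
  generically (fun m : 'M[R[i]]_(3, 2) =>
    forall a b c A B C : R[i], solves_system m a b c A B C ->
    let e := - (1 + a + b + c) in
    let E := - (1 + A + B + C) in
    let f := explicit_map a b c e A B C E in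
    is_associated_involution (seven_points m) f /\
    is_Geiser_involution (seven_points m) f).
Proof. exact: generic_Geiser. Qed.
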